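(* Let $0<p<q<\infty$, and let $\{p,\kappa_{d,p}\}$ and $\{q,\kappa_{d,q}\}$ be sequences of tests each of which has an asymptotic size in $(0,1)$ (the two asymptotic sizes need not coincide). Then $$\mathscr{C}(\{p,\kappa_{d,p}\}) \subsetneqq \mathscr{C}(\{q,\kappa_{d,q}\}).$$
   Context: Let $\varepsilon_1,\varepsilon_2,\dots$ be i.i.d. standard normal random variables and $\boldsymbol{\varepsilon}_d = (\varepsilon_1,\dots,\varepsilon_d)$. A (sequence of) test(s) is a sequence $\varphi_d$, $d\in\mathbb{N}$, of Borel measurable functions $\varphi_d:\mathbb{R}^d \to [0,1]$; it has asymptotic size $\alpha\in[0,1]$ if $\lim_{d\to\infty}\mathbb{E}(\varphi_d(\boldsymbol{\varepsilon}_d)) = \alpha$. Let $\boldsymbol{\Theta} := \prod_{d=1}^\infty \mathbb{R}^d$ be the set of all triangular arrays $\boldsymbol{\vartheta} = \{\boldsymbol{\theta}_d: d\in\mathbb{N}\}$, $\boldsymbol{\theta}_d\in\mathbb{R}^d$. The consistency set $\mathscr{C}(\varphi_d)\subseteq\boldsymbol{\Theta}$ of a sequence of tests $\varphi_d$ is the set of all $\boldsymbol{\vartheta}\in\boldsymbol{\Theta}$ with $\lim_{d\to\infty}\mathbb{E}(\varphi_d(\boldsymbol{\theta}_d+\boldsymbol{\varepsilon}_d)) = 1$. For $\boldsymbol{x}\in\mathbb{R}^d$ and $p\in(0,\infty)$, $\|\boldsymbol{x}\|_p := (\sum_{i=1}^d |x_i|^p)^{1/p}$ (also for $p<1$). For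 a sequence of real critical values $\kappa_d$, $\{p,\kappa_d\}$ denotes the sequence of tests $\mathbf{1}\{\|\cdot\|_p \ge \kappa_d\}$. *)

(* Defs.v *)
From HB Require Import structures.
From mathcomp Require Import all_boot all_order all_algebra finmap.
From mathcomp Require Import all_classical all_reals all_analysis.
From mathcomp Require Import measurable_realfun.

Set Implicit Arguments.
Unset Strict Implicit.
Unset Printing Implicit Defensive.
Import Order.TTheory GRing.Theory Num.Theory.
Import numFieldNormedType.Exports.
Local Open Scope classical_set_scope.
Local Open Scope ring_scope.

(* R^d with its Borel sigma-algebra: 'rV[R]_d carries the product topology. *)
Definition borel_vec (R : realType) (d : nat) :=
  g_sigma_algebraType (@open 'rV[R]_d).

Record test (R : realType) (d : nat) := Test {
  test_fun :> 'rV[R]_d -> R;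
  test_measurable :
    measurable_fun setT (test_fun : borel_vec R d -> measurableTypeR R);
  test_range : forall x, 0 <= test_fun x <= 1 }.

(* In every sequence below the term of index n belongs to the dimension
   d = n.+1, so that d ranges over the positive integers. *)
Definition test_sequence (R : realType) := forall n : nat, test R n.+1.

Definition triangular_array (R : realType) := forall n : nat, 'rV[R]_n.+1.

Definition mutually_independent d (T : measurableType d) (R : realType)
    (P : probability T R) (X : nat -> {RV P >-> R}) : Prop :=
  forall (J : {fset nat}) (A : nat -> set R),
    (forall i, measurable (A i : set (measurableTypeR R))) ->
    P (\bigcap_(i in [set` J]) (X i @^-1` A i)) =
    (\prod_(i <- J) P (X i @^-1` A i))%E.

(* eps i is the (i+1)-st standard normal variable. *)
Definition iid_standard_normal d (T : measurableType d) (R : realType)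
    (P : probability T R) (eps : nat -> {RV P >-> R}) : Prop :=
  mutually_independent eps /\
  forall i (A : set (measurableTypeR R)), measurable A ->
    distribution P (eps i) A = normal_prob 0 1 A.

Definition noise_vec d (T : measurableType d) (R : realType)
    (P : probability T R) (eps : nat -> {RV P >-> R}) (n : nat) (w : T)
    : 'rV[R]_n := \row_(i < n) eps i w.

Definition has_asymptotic_size d (T : measurableType d) (R : realType)
    (P : probability T R) (eps : nat -> {RV P >-> R})
    (phi : test_sequence R) (alpha : R) : Prop :=
  'E_P[fun w => phi n (noise_vec eps n.+1 w)]%E @[n --> \oo] --> alpha%:E.

Definition consistency_set d (T : measurableType d) (R : realType)
    (P : probability T R) (eps : nat -> {RV P >-> R})
    (phi : test_sequence R) : set (triangular_array R) :=
  [set theta | 'E_P[fun w => phi n (theta n + noise_vec eps n.+1 w)%R]%E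
                 @[n --> \oo] --> 1%:E].

Definition pnorm (R : realType) (d : nat) (p : R) (x : 'rV[R]_d) : R :=
  (\sum_(i < d) `|x 0 i| `^ p) `^ p^-1.

Definition rejection_region (R : realType) (d : nat) (p kappa : R)
  : set 'rV[R]_d := [set x | kappa <= pnorm p x].

Lemma measurable_coord (R : realType) (d : nat) (i : 'I_d) :
  measurable_fun setT
    ((fun x : 'rV[R]_d => x 0 i) : borel_vec R d -> measurableTypeR R).
Proof.
apply: (measurability _ (RGenOpens.measurableE R)).
move=> _ [_ [a [b ->] <-]].
rewrite setTI; apply: sub_sigma_algebra.
apply: (@open_comp _ _ (fun x : 'rV[R]_d => x 0 i)); last exact: interval_open.
by move=> x _; exact: coord_continuous.
Qed.

Lemma measurable_pnorm (R : realType) (d : nat) (p : R) :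
  measurable_fun setT (@pnorm R d p : borel_vec R d -> measurableTypeR R).
Proof.
apply: (measurableT_comp (measurable_powR _)).
apply: measurable_sum => i.
apply: (measurableT_comp (measurable_powR _)).
apply: (measurableT_comp (@normr_measurable R setT)).
exact: measurable_coord.
Qed.

Lemma measurable_rejection_region (R : realType) (d : nat) (p kappa : R) :
  measurable (rejection_region p kappa : set (borel_vec R d)).
Proof.
have -> : rejection_region p kappa =
    setT `&` (@pnorm R d p @^-1` `[kappa, +oo[).
  by rewrite setTI; apply/seteqP; split=> x; rewrite /= in_itv/= andbT.
by apply: measurable_pnorm => //; exact: measurable_itv.
Qed.

Lemma measurable_pnorm_test (R : realType) (d : nat) (p kappa : R) :
  measurable_fun setT
    ((\1_(rejection_region p kappa) : 'rV[R]_d -> R)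
       : borel_vec R d -> measurableTypeR R).
Proof.
apply: (@measurable_indic _ (borel_vec R d) R).
exact: measurable_rejection_region.
Qed.

Lemma pnorm_test_range (R : realType) (d : nat) (p kappa : R) (x : 'rV[R]_d) :
  0 <= (\1_(rejection_region p kappa) x : R) <= 1.
Proof. by rewrite indicE; case: (_ \in _); rewrite /= ?lexx ?ler01. Qed.

Definition pnorm_tests (R : realType) (p : R) (kappa : nat -> R)
    : test_sequence R := fun n =>
  Test (@measurable_pnorm_test R n.+1 p (kappa n))
       (@pnorm_test_range R n.+1 p (kappa n)).

(* Main.v *)
Require Import Defs.
From mathcomp Require Import all_boot all_order all_algebra finmap.
From mathcomp Require Import all_classical all_reals all_analysis.
From mathcomp Require Import measurable_realfun.
From mathcomp Require Import ring lra.
Set Implicit Arguments.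
Unset Strict Implicit.
Unset Printing Implicit Defensive.
Import Order.TTheory GRing.Theory Num.Theory.
Import numFieldNormedType.Exports.
Local Open Scope classical_set_scope.
Local Open Scope ring_scope.

(** Write [S_p(theta) = sum_i |theta_i + eps_i|^p], [mu p = E |eps_i|^p] and let
    [g_p(t)] be [t^2] for [|t| <= 1] and [|t|^p] otherwise.  By Chebyshev, the
    asymptotic size forces the critical value of [S_p] into
    [d * mu p + O(sqrt d)].  The consistency set is then the set of arrays with
    [sum_i g_p(theta_i) / sqrt d -> oo]:
    - [E |t + eps|^p - mu p] lies between two multiples of [g_p(t)], and the
      variance of [S_p(theta)] is [O(d)] plus a small multiple of
      [(sum_i g_p(theta_i))^2], so divergence implies consistency;
    - if [sum_i g_p(theta_i) = O(sqrt d)], rescaling the noise by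
      [sqrt (1 - a / sqrt d)] lowers the mean of [S_p(theta)] by a prescribed
      multiple of [sqrt d] while the likelihood ratio keeps a bounded second
      moment, so the acceptance probability stays away from 0.
    Since [g_p <= g_q], the inclusion follows.  It is strict because of the array
    with the single nonzero coordinate [d^(1/(2p))]. *)

(** * Independence of functions of the noise *)

(** The quadratic regime of [g_p] comes from symmetry: the law of [eps] is even, so the term linear
    in [t] of [E |t + eps|^p] cancels and a small shift is felt only through [t^2]. For [p < 1] the
    function [|x|^p] is not convex, so Jensen's inequality cannot give the lower bound. Instead the
    shift is written as a weight [cosh (t x)], which is positively correlated with [|x|^p] because
    both increase with [|x|]. Chebyshev's inequality takes the place of a limit law for [S_p]:
    whether the power tends to 1 is decided by probability bounds that are uniform over all [theta]
    with a given bound on [sum_i g_p(theta_i)]. Uniformity matters because the array changes with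
    [d]. Noise of variance [1 - v] changes each mean to first order in [v], whereas the second
    moment of its likelihood ratio is at most [exp (v^2)] per coordinate. With [v = a / sqrt d], the
    [d] coordinates together gain order [sqrt d] at the bounded cost [exp (a^2)]. The resulting
    criterion mentions neither critical values nor sizes, so tests of different sizes can be
    compared. *)

Section Density.
Context {d d'} {X : measurableType d} {Y : measurableType d'} {R : realType}.
Variables (mu : {measure set X -> \bar R}) (nu : {measure set Y -> \bar R}).
Import HBNNSimple.

(** Monotone convergence along simple functions extends the identity from indicators to [f]. The
    weight [W] has two uses: the product of the other noise factors in the independence argument,
    and the normal density with [phi = id]. *)
Lemma ge0_integral_density (W : X -> R) (phi : X -> Y) (c : R) (f : Y -> R) :
  measurable_fun setT W -> (forall x, 0 <= W x) ->
  measurable_fun setT phi -> 0 <= c ->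
  (forall B, measurable B ->
    (\int[mu]_x (W x * \1_B (phi x))%:E = c%:E * nu B)%E) ->
  measurable_fun setT f -> (forall y, 0 <= f y) ->
  (\int[mu]_x (W x * f (phi x))%:E = c%:E * \int[nu]_y (f y)%:E)%E.
Proof.
move=> mW W0 mphi c0 WB mf f0.
have mEf : measurable_fun setT (EFin \o f) by exact/measurable_EFinP.
have fE0 y : setT y -> (0 <= (EFin \o f) y)%E by move=> _; rewrite lee_fin.
pose h := nnsfun_approx measurableT mEf.
have hcvg y : (EFin \o h^~ y) @ \oo --> (f y)%:E by exact: cvg_nnsfun_approx.
have hnd y m n : (m <= n)%N -> h m y <= h n y.
  by move=> mn; exact/lefP/nd_nnsfun_approx.
have mh n : measurable_fun setT (h n) by exact/measurable_funP.
have -> : (\int[nu]_y (f y)%:E = lim (\int[nu]_y (h n y)%:E @[n --> \oo]))%E.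
  rewrite -monotone_convergence//.
  - by apply: eq_integral => y _; apply/esym/cvg_lim => //; exact: hcvg.
  - by move=> n; exact/measurable_EFinP.
  - by move=> n y _; rewrite lee_fin.
  - by move=> y _ m n mn; rewrite lee_fin hnd.
have mWh n : measurable_fun setT (fun x => W x * h n (phi x)).
  by apply: measurable_funM => //; exact: measurableT_comp.
have -> : (\int[mu]_x (W x * f (phi x))%:E =
    lim (\int[mu]_x (W x * h n (phi x))%:E @[n --> \oo]))%E.
  rewrite -monotone_convergence//.
  - apply: eq_integral => x _; apply/esym/cvg_lim => //.
    have Wfin : (W x)%:E \is a fin_num by [].
    exact: (cvgeZl Wfin (hcvg (phi x))).
  - by move=> n; exact/measurable_EFinP.
  - by move=> n y _; rewrite lee_fin mulr_ge0.
  - by move=> y _ m n mn; rewrite lee_fin ler_wpM2l// hnd.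
have c0' : (0 <= c%:E)%E by rewrite lee_fin.
have nuh0 n : (0 <= \int[nu]_y (h n y)%:E)%E.
  by apply: integral_ge0 => y _; rewrite lee_fin.
rewrite -limeMl//; last first.
  apply: ereal_nondecreasing_is_cvgn => m n mn.
  apply: ge0_le_integral => //.
  - by move=> y _; rewrite lee_fin.
  - exact/measurable_EFinP.
  - exact/measurable_EFinP.
  - by move=> y _; rewrite lee_fin hnd.
apply: congr_lim; apply/funext => n /=.
have mpre r : measurable (h n @^-1` [set r]) by rewrite -[_ @^-1` _]setTI; exact: mh.
have mind r : measurable_fun setT (fun x => W x * \1_(h n @^-1` [set r]) (phi x)).
  by apply: measurable_funM => //; apply: measurableT_comp => //; exact: measurable_indic.
transitivity (\int[mu]_x (\sum_(r \in range (h n))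
    r%:E * (W x * \1_(h n @^-1` [set r]) (phi x))%:E)%E)%E.
  apply: eq_integral => x _.
  rewrite fimfunE EFinM -fsumEFin// ge0_mule_fsumr; last first.
    by move=> r; exact: nnfun_muleindic_ge0.
  by apply: eq_fsbigr => r _; rewrite !EFinM muleCA.
rewrite ge0_integral_fsum//; last 2 first.
  - move=> r; under eq_fun do rewrite -EFinM.
    by apply/measurable_EFinP/measurable_funM.
  - move=> r x _.
    have [r0|r0] := leP 0 r; first by rewrite mule_ge0// lee_fin mulr_ge0.
    by rewrite preimage_nnfun0// indic0 mulr0 mule0.
under [in RHS]eq_integral do rewrite fimfunE -fsumEFin//.
rewrite ge0_integral_fsum//; last 2 first.
  - by move=> r; apply/measurable_EFinP/measurable_funM => //; exact: measurable_indic.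
  - by move=> r y _; exact: nnfun_muleindic_ge0.
rewrite ge0_mule_fsumr; last first.
  by move=> r; apply: integral_ge0 => y _; exact: nnfun_muleindic_ge0.
apply: eq_fsbigr => r; rewrite inE => -[y _ <-].
rewrite integralZl_indic_nnsfun// integral_indic// setIT.
rewrite ge0_integralZl//.
- by rewrite WB// muleCA.
- exact/measurable_EFinP/mind.
- by move=> x _; rewrite lee_fin mulr_ge0.
- by rewrite lee_fin.
Qed.
End Density.

Section Independence.
Context {R : realType} {disp : measure_display} {T : measurableType disp}.
Context {P : probability T R} {eps : nat -> {RV P >-> R}}.
Hypothesis heps : iid_standard_normal eps.
Local Notation N := (normal_prob (0 : R) 1).

Lemma measurable_prod_noise n (f : nat -> R -> R) (Q : pred 'I_n) :
  (forall i, measurable_fun setT (f i)) ->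
  measurable_fun setT (fun w => \prod_(i < n | Q i) f i (eps i w)).
Proof.
move=> mf; under eq_fun do rewrite -big_filter.
apply: measurable_prod => i _.
by apply: measurableT_comp => //; exact: measurable_funP.
Qed.

Lemma integral_prod_indic n (A : nat -> set R) :
  (forall i, measurable (A i : set (measurableTypeR R))) ->
  (\int[P]_w (\prod_(i < n) \1_(A i) (eps i w) : R)%:E =
   (\prod_(i < n) fine (N (A i)))%:E)%E.
Proof.
move=> mA; pose J : {fset nat} := [fset i in iota 0 n]%fset.
have JE i : (i \in J) = (i < n)%N by rewrite !inE mem_iota.
have mX i : measurable (eps i @^-1` A i).
  exact: (measurable_funPTI (eps i) (mA i)).
have PX i : P (eps i @^-1` A i) = N (A i) by rewrite -(heps.2 i).
rewrite (big_morph EFin (@EFinM _) (erefl _)).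
under [RHS]eq_bigr => i _ do rewrite fineK ?fin_num_measure// -PX.
rewrite -(big_mkord xpredT (fun i => P (eps i @^-1` A i))).
have <- : (\prod_(i <- J) P (eps i @^-1` A i) =
    \prod_(0 <= i < n) P (eps i @^-1` A i))%E.
  apply: perm_big; apply: uniq_perm => [||i]; rewrite ?iota_uniq//.
  by rewrite -[LHS]/(i \in J) JE mem_index_iota.
rewrite -(heps.1 J A mA) -[X in P X]setTI setIC -integral_indic//; last first.
  by apply: fin_bigcap_measurable => //; exact: finite_fset.
apply: eq_integral => w _; congr (_%:E).
rewrite indicE; case: (boolP (w \in _)) => [|wJ].
  rewrite inE => wJ; rewrite big1// => i _.
  have iJ : [set` J] (nat_of_ord i) by rewrite /= JE.
  have /mem_set wA : (A i) (eps i w) := wJ i iJ.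
  by rewrite indicE wA.
have [i iJ iA] : exists2 i, i \in J & ~ A i (eps i w).
  apply: contrapT => h; move/negP: wJ; apply; rewrite inE => i /= iJ.
  by apply: contrapT => iA; apply: h; exists i.
rewrite JE in iJ; apply/eqP; rewrite prodf_seq_eq0; apply/hasP.
exists (Ordinal iJ); first by rewrite mem_index_enum.
by rewrite /= indicE memNset.
Qed.

Lemma integral_prod_noise n (f : nat -> R -> R) :
  (forall i, measurable_fun setT (f i)) -> (forall i x, 0 <= f i x) ->
  (forall i, N.-integrable setT (EFin \o f i)) ->
  (\int[P]_w (\prod_(i < n) f i (eps i w))%:E =
   (\prod_(i < n) \int[N]_x f i x)%:E)%E.
Proof.
move=> mf f0 intf.
have mI (A : nat -> set R) k i :
    (forall i, measurable (A i : set (measurableTypeR R))) ->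
    measurable_fun setT (if (i < k)%N then f i else \1_(A i)).
  by move=> mA; case: ifP => // _; apply: measurable_indic (mA i).
(* Independence is the case of indicators, which are replaced by the [f i] one
   at a time. *)
suff H k (A : nat -> set R) : (k <= n)%N ->
    (forall i, measurable (A i : set (measurableTypeR R))) ->
    (\int[P]_w (\prod_(i < n)
        (if (i < k)%N then f i else \1_(A i)) (eps i w))%:E =
     (\prod_(i < n) \int[N]_x (if (i < k)%N then f i else \1_(A i)) x)%:E)%E.
  have := H n (fun=> setT) (leqnn n) (fun=> measurableT).
  under eq_integral => w _ do under eq_bigr => i _ do rewrite ltn_ord.
  by move=> ->; under eq_bigr => i _ do rewrite ltn_ord.
elim: k A => [|k IH] A kn mA.
  rewrite [LHS](integral_prod_indic n mA); congr (_%:E).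
  by apply: eq_bigr => i _; rewrite /Rintegral integral_indic// setIT.
pose k' := Ordinal kn.
set F := fun i => if (i < k.+1)%N then f i else \1_(A i).
have F0 i x : 0 <= F i x by rewrite /F; case: ifP.
have mF i : measurable_fun setT (F i) by exact: mI.
rewrite [in RHS](bigD1 k')//= ltnSn EFinM muleC.
have -> : (\int[N]_x f k x)%:E = (\int[N]_x (f k x)%:E)%E.
  by rewrite fineK//; exact: (integrable_fin_num measurableT (intf k)).
under eq_integral => w _ do rewrite (bigD1 k')//= ltnSn mulrC.
apply: (@ge0_integral_density _ _ _ _ _ P N
  (fun w => \prod_(i < n | i != k') F i (eps i w)) (eps k)) => //.
- exact: measurable_prod_noise.
- by move=> w /=; apply: prodr_ge0 => i _; exact: F0.
- exact: (measurable_funP (eps k)).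
- apply: prodr_ge0 => i _; apply: Rintegral_ge0 => x _; exact: F0.
(* For an event [B] the required identity is the induction hypothesis for the family [A] with its
   [k]-th set replaced by [B]. *)
- move=> B mB; pose A' i := if i == k then B else A i.
  have mA' i : measurable (A' i : set (measurableTypeR R)).
    by rewrite /A'; case: ifP.
  have FA' i : i != k' -> (if (i < k)%N then f i else \1_(A' i)) = F i.
    rewrite -val_eqE /F /A' [in RHS]ltnS [in RHS]leq_eqVlt /= => /negbTE ik.
    by rewrite ik.
  have := IH A' (ltnW kn) mA'.
  rewrite [in RHS](bigD1 k')//= ltnn {2}/A' eqxx EFinM muleC.
  rewrite (eq_bigr (fun i : 'I_n => \int[N]_x F i x)); last first.
    by move=> i ik; rewrite FA'.
  have -> : (\int[N]_x (\1_B x : R))%:E = N B.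
    rewrite /Rintegral integral_indic// setIT fineK// fin_num_measure//.
  move=> <-; apply: eq_integral => w _; congr (_%:E).
  have Ak : A' k = B by rewrite /A' eqxx.
  rewrite [RHS](bigD1 k')//= ltnn Ak mulrC; congr (_ * _).
  by apply: eq_bigr => i ik; rewrite FA'.
- exact: mf.
Qed.
End Independence.

(** * Chebyshev's inequality under a product tilt *)

Section WeightedChebyshev.
Context {R : realType} {disp : measure_display} {T : measurableType disp}.
Context {P : probability T R} {eps : nat -> {RV P >-> R}}.
Hypothesis heps : iid_standard_normal eps.
Local Notation N := (normal_prob (0 : R) 1).
Variables (n : nat) (l h : nat -> R -> R).
Hypotheses (ml : forall i, measurable_fun setT (l i))
           (mh : forall i, measurable_fun setT (h i)).
Hypotheses (l0 : forall i x, 0 <= l i x) (h0 : forall i x, 0 <= h i x).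
Hypothesis int_lh : forall i e, (e <= 2)%N ->
  N.-integrable setT (EFin \o (fun x => l i x * h i x ^+ e)).
Hypothesis l1 : forall i, \int[N]_x l i x = 1.

(** Under the law with density [L] the coordinates are independent with densities [l i] relative to
    N(0, 1), and [v i e] is the moment of order [e] of [h i]. Weighted integrals under [P] stand in
    for that law; [l i = 1] gives back [P]. *)
Let L w := \prod_(i < n) l i (eps i w).
Let S w := \sum_(i < n) h i (eps i w).
Let v i e := \int[N]_x (l i x * h i x ^+ e).

Let v0 i : v i 0 = 1.
Proof. by rewrite -[RHS](l1 i); apply: eq_Rintegral => x _; rewrite expr0 mulr1. Qed.

Let integral_prodX (e : nat -> nat) : (forall i, (e i <= 2)%N) ->
  (\int[P]_w (\prod_(i < n) (l i (eps i w) * h i (eps i w) ^+ e i))%:E =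
   (\prod_(i < n) v i (e i))%:E)%E.
Proof.
move=> e2; apply: (@integral_prod_noise _ _ _ _ _ heps n (fun i x => l i x * h i x ^+ e i)).
- by move=> i; apply: measurable_funM => //; exact: measurable_funX.
- by move=> i x; rewrite mulr_ge0 ?exprn_ge0.
- by move=> i; exact: int_lh.
Qed.

(** The exponent [k == i], read as 0 or 1, writes a single factor as a product over all coordinates,
    the shape that independence can integrate. *)
Let prod_pick (c : nat -> R) (i : 'I_n) : \prod_(k < n) c k ^+ (k == i :> nat) = c i.
Proof.
rewrite (bigD1 i)//= eqxx expr1 big1 ?mulr1// => k ki.
by rewrite -[X in _ ^+ X]/(nat_of_bool (k == i)) (negbTE ki) expr0.
Qed.

Let mL : measurable_fun setT L.
Proof. exact: (@measurable_prod_noise _ _ _ _ _ n l xpredT ml). Qed.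
Let mS : measurable_fun setT S.
Proof.
by apply: measurable_sum => i; apply: (measurableT_comp (mh i)); exact: (measurable_funP (eps i)).
Qed.
Let L0 w : 0 <= L w. Proof. exact: prodr_ge0. Qed.
Let S0 w : 0 <= S w. Proof. exact: sumr_ge0. Qed.

Let integral_L : (\int[P]_w (L w)%:E = 1)%E.
Proof.
have := @integral_prodX (fun=> 0) (fun=> isT).
rewrite big1 => [<-|i _]; last exact: v0.
apply: eq_integral => w _; congr (_%:E); apply: eq_bigr => i _.
by rewrite expr0 mulr1.
Qed.

Let integral_LS : (\int[P]_w (L w * S w)%:E = (\sum_(i < n) v i 1)%:E)%E.
Proof.
pose u (i : 'I_n) w := \prod_(k < n) (l k (eps k w) * h k (eps k w) ^+ (k == i :> nat)).
transitivity (\int[P]_w (\sum_(i < n) (u i w)%:E))%E.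
  apply: eq_integral => w _; rewrite sumEFin mulr_sumr; congr (_%:E).
  by apply: eq_bigr => i _; rewrite /u big_split/= (prod_pick (fun k => h k (eps k w))).
have mu i : measurable_fun setT (u i).
  apply: (@measurable_prod_noise _ _ _ _ _ n (fun k x => l k x * h k x ^+ (k == i :> nat)) xpredT).
  by move=> k; apply: measurable_funM => //; exact: measurable_funX.
rewrite ge0_integral_sum//.
- rewrite -sumEFin; apply: eq_bigr => i _.
  rewrite (@integral_prodX (fun k => (k == i :> nat))); last by move=> k; case: eqP.
  congr (_%:E); rewrite (bigD1 i)//= eqxx big1 ?mulr1// => k ki.
  by rewrite -[X in v _ X]/(nat_of_bool (k == i)) (negbTE ki).
- by move=> i; exact/measurable_EFinP.
- by move=> i w _; rewrite lee_fin; apply: prodr_ge0 => k _; rewrite mulr_ge0 ?exprn_ge0.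
Qed.

(** In the expanded square, [e i j k] counts how many of [i] and [j] equal [k]. Off the diagonal the
    moments multiply to [v i 1 * v j 1]; on it they give [v i 2], whose excess over [v i 1 ^+ 2] is
    the tilted variance. *)
Let integral_LS2 : (\int[P]_w (L w * S w ^+ 2)%:E =
  ((\sum_(i < n) v i 1) ^+ 2 + \sum_(i < n) (v i 2 - v i 1 ^+ 2))%:E)%E.
Proof.
pose e (i j : 'I_n) (k : nat) := ((k == i :> nat) + (k == j :> nat))%N.
pose u (i j : 'I_n) w := \prod_(k < n) (l k (eps k w) * h k (eps k w) ^+ e i j k).
transitivity (\int[P]_w (\sum_(i < n) \sum_(j < n) (u i j w)%:E))%E.
  apply: eq_integral => w _; under eq_bigr => i _ do rewrite sumEFin.
  rewrite sumEFin; congr (_%:E).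
  rewrite expr2 mulrA mulr_sumr [RHS]exchange_big /=; apply: eq_bigr => j _.
  rewrite mulr_sumr mulr_suml; apply: eq_bigr => i _; rewrite /u /e.
  under [RHS]eq_bigr => k _ do rewrite exprD mulrA.
  by rewrite !big_split/= !(prod_pick (fun k => h k (eps k w))).
have mu i j : measurable_fun setT (u i j).
  apply: (@measurable_prod_noise _ _ _ _ _ n (fun k x => l k x * h k x ^+ e i j k) xpredT).
  by move=> k; apply: measurable_funM => //; exact: measurable_funX.
have u0 i j w : 0 <= u i j w.
  by apply: prodr_ge0 => k _; rewrite mulr_ge0 ?exprn_ge0.
have vij (i j : 'I_n) : \prod_(k < n) v k (e i j k) =
    v i 1 * v j 1 + (if i == j then v i 2 - v i 1 ^+ 2 else 0).
  case: eqVneq => [<-|ij].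
    rewrite (bigD1 i)//= /e eqxx big1 ?mulr1; first by rewrite expr2 addrC subrK.
    by move=> k ki; rewrite -[(k == i :> nat)]/(k == i) (negbTE ki).
  rewrite addr0 (bigD1 i)//= (bigD1 j) 1?eq_sym//= /e !eqxx.
  rewrite -[(i == j :> nat)]/(i == j) -[(j == i :> nat)]/(j == i).
  rewrite (negbTE ij) eq_sym (negbTE ij) big1 ?mulr1// => k /andP[ki kj].
  by rewrite -[(k == i :> nat)]/(k == i) -[(k == j :> nat)]/(k == j) (negbTE ki) (negbTE kj).
have e2 i j k : (e i j k <= 2)%N by rewrite /e; do 2 case: eqP => _.
rewrite ge0_integral_sum//.
- transitivity (\sum_(i < n) \sum_(j < n) (\prod_(k < n) v k (e i j k))%:E)%E.
    apply: eq_bigr => i _; rewrite ge0_integral_sum//.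
    + by apply: eq_bigr => j _; rewrite (@integral_prodX (e i j)).
    + by move=> j; exact/measurable_EFinP.
    + by move=> j w _; rewrite lee_fin.
  under eq_bigr => i _ do rewrite sumEFin.
  rewrite sumEFin; congr (_%:E).
  transitivity (\sum_(i < n) (v i 1 * (\sum_(j < n) v j 1) + (v i 2 - v i 1 ^+ 2))).
    apply: eq_bigr => i _; under eq_bigr => j _ do rewrite vij.
    rewrite big_split/= -mulr_sumr -big_mkcond/=; congr (_ + _).
    by apply: big_pred1 => j; rewrite /= eq_sym.
  by rewrite big_split/= -mulr_suml expr2.
- move=> i; under eq_fun do rewrite sumEFin.
  by apply/measurable_EFinP; exact: measurable_sum.
- by move=> i w _; rewrite sume_ge0// => j _; rewrite lee_fin.
Qed.

Lemma weighted_chebyshev (V c : R) : 0 < c ->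
  \sum_(i < n) (v i 2 - v i 1 ^+ 2) <= V ->
  (\int[P]_w (L w * \1_[set w | (c <= `|S w - \sum_(i < n) v i 1|)%R] w)%:E <=
   (V / c ^+ 2)%:E)%E.
Proof.
move=> c0 DV; set m := \sum_(i < n) v i 1; set B := [set w | _].
have mB : measurable B.
  have -> : B = (fun w => `|S w - m|) @^-1` `[c, +oo[.
    by apply/seteqP; split => w; rewrite /B/= in_itv/= andbT.
  rewrite -[_ @^-1` _]setTI.
  have mSm : measurable_fun setT (fun w => `|S w - m|).
    by apply: measurableT_comp => //; exact: measurable_funB.
  exact: mSm.
have mLB : measurable_fun setT (fun w => L w * \1_B w).
  by apply: measurable_funM => //; exact: measurable_indic.
have LB0 w : 0 <= L w * \1_B w by rewrite mulr_ge0.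
have m0 : 0 <= m.
  by apply: sumr_ge0 => i _; apply: Rintegral_ge0 => x _; rewrite mulr_ge0 ?exprn_ge0.
have LS0 w : 0 <= L w * S w by rewrite mulr_ge0.
have mLS : measurable_fun setT (fun w => L w * S w) by exact: measurable_funM.
have LS20 w : 0 <= L w * S w ^+ 2 by rewrite mulr_ge0 ?exprn_ge0.
have mLS2 : measurable_fun setT (fun w => L w * S w ^+ 2).
  by apply: measurable_funM => //; exact: measurable_funX.
(* This is [c^2 1_B <= (S - m)^2] multiplied by [L], with the cross term moved to the left so that
   both integrands are nonnegative. *)
have : (\int[P]_w ((c ^+ 2)%:E * (L w * \1_B w)%:E + (2 * m)%:E * (L w * S w)%:E) <=
  \int[P]_w ((L w * S w ^+ 2)%:E + (m ^+ 2)%:E * (L w)%:E))%E.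
  apply: ge0_le_integral => //.
  - move=> w _; rewrite -!EFinM -EFinD lee_fin.
    by rewrite addr_ge0 // mulr_ge0 ?sqr_ge0 ?(mulr_ge0 _ m0).
  - under eq_fun do rewrite -!EFinM -EFinD.
    apply/measurable_EFinP/measurable_funD; exact: measurable_funM.
  - under eq_fun do rewrite -!EFinM -EFinD.
    by apply/measurable_EFinP/measurable_funD => //; exact: measurable_funM.
  - move=> w _; rewrite -!EFinM -!EFinD lee_fin.
    suff : L w * (c ^+ 2 * \1_B w) <= L w * (S w - m) ^+ 2 by lra.
    rewrite ler_wpM2l// indicE; case: (boolP (w \in B)) => wB; last first.
      by rewrite mulr0 sqr_ge0.
    rewrite mulr1 -[leRHS]real_normK ?num_real//.
    by rewrite ler_sqr ?nnegrE ?(ltW c0)//; move: wB; rewrite inE.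
have Z k (f : T -> R) : 0 <= k -> measurable_fun setT f -> (forall w, 0 <= f w) ->
    [/\ measurable_fun setT (fun w => k%:E * (f w)%:E)%E,
      (forall w, setT w -> 0 <= k%:E * (f w)%:E)%E &
      (\int[P]_w (k%:E * (f w)%:E) = k%:E * \int[P]_w (f w)%:E)%E].
  move=> k0 mf f0; split.
  - by under eq_fun do rewrite -EFinM; apply/measurable_EFinP; exact: measurable_funM.
  - by move=> w _; rewrite -EFinM lee_fin mulr_ge0.
  - apply: ge0_integralZl => //; first exact/measurable_EFinP.
    by move=> w _; rewrite lee_fin.
have m20 : 0 <= 2 * m by rewrite mulr_ge0.
have [m1 p1 i1] := Z _ _ (sqr_ge0 c) mLB LB0.
have [m2 p2 i2] := Z _ _ m20 mLS LS0.
have [m3 p3 i3] := Z _ _ (sqr_ge0 m) mL L0.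
rewrite (ge0_integralD _ measurableT p1 m1 p2 m2).
rewrite (ge0_integralD _ measurableT _ _ p3 m3)//; last 2 first.
- by move=> w _; rewrite lee_fin.
- exact/measurable_EFinP.
rewrite i1 i2 i3 integral_L integral_LS integral_LS2 -/m mule1.
set X := (\int[P]_x (L x * \1_B x)%:E)%E.
(* The bound serves to make [X] finite, so that the inequality can be read in [R]. *)
have : (X <= 1)%E.
  rewrite -integral_L; apply: ge0_le_integral => //.
  - by move=> w _; rewrite lee_fin.
  - exact/measurable_EFinP.
  - exact/measurable_EFinP.
  - by move=> w _; rewrite lee_fin ler_piMr// indicE; case: (_ \in _).
case: X => [x| |]//; last by move=> _ _; rewrite leNye.
rewrite -!EFinM -!EFinD !lee_fin => _ le.
by rewrite ler_pdivlMr ?exprn_gt0// mulrC; lra.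
Qed.

(** An event of tilted mass at least 1/2 keeps a definite mass under [P] when the likelihood ratio
    has second moment at most [K]. The constant is the one that Cauchy-Schwarz gives for [L] and
    [1_B]; here it comes from integrating a pointwise bound, [1/2 <= 1/4 + K P(B)]. *)
Lemma prob_tilt_le (B : set T) (K : R) : measurable B -> 0 < K -> 
  \prod_(i < n) \int[N]_y (l i y ^+ 2) <= K ->
  (forall i, N.-integrable setT (EFin \o (fun x => l i x ^+ 2))) ->
  (2^-1%:E <= \int[P]_w (L w * \1_B w)%:E)%E -> ((4 * K)^-1%:E <= P B)%E.
Proof.
move=> mB K0 hK il hB.
have mLB : measurable_fun setT (fun w => L w * \1_B w).
  by apply: measurable_funM => //; exact: measurable_indic.
have mL2 : measurable_fun setT (fun w => (4 * K)^-1 * L w ^+ 2).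
  by apply: measurable_funM => //; exact: measurable_funX.
have iL2 : (\int[P]_w (L w ^+ 2)%:E = (\prod_(i < n) \int[N]_y (l i y ^+ 2))%:E)%E.
  have ml2 i : measurable_fun setT (fun x => l i x ^+ 2) by exact: measurable_funX.
  have l20 i x : 0 <= l i x ^+ 2 by exact: sqr_ge0.
  rewrite -(integral_prod_noise heps n ml2 l20 il).
  by apply: eq_integral => w _; rewrite -prodrXl.
have K40 : 0 < (4 * K)^-1 by rewrite invr_gt0 mulr_gt0.
have : (\int[P]_w (L w * \1_B w)%:E <=
    \int[P]_w (((4 * K)^-1 * L w ^+ 2)%:E + (K * \1_B w)%:E))%E.
  apply: ge0_le_integral => //.
  - by move=> w _; rewrite lee_fin mulr_ge0.
  - exact/measurable_EFinP.
  - under eq_fun do rewrite -EFinD.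
    apply/measurable_EFinP/measurable_funD => //.
    by apply: measurable_funM => //; exact: measurable_indic.
  - move=> w _; rewrite -EFinD lee_fin indicE; case: (w \in B); last first.
      by rewrite !mulr0 addr0 mulr_ge0 ?sqr_ge0// ltW.
    rewrite !mulr1.
    (* AM-GM: [L <= L^2 / (4 K) + K] *)
    suff : 0 <= (4 * K)^-1 * (L w - 2 * K) ^+ 2.
      have -> : (4 * K)^-1 * (L w - 2 * K) ^+ 2 = (4 * K)^-1 * L w ^+ 2 - L w + K.
        by field; rewrite gt_eqF.
      by lra.
    by rewrite mulr_ge0 ?sqr_ge0// ltW.
move=> /(le_trans hB).
have L20 w : setT w -> (0 <= ((4 * K)^-1 * L w ^+ 2)%:E)%E.
  by move=> _; rewrite lee_fin mulr_ge0 ?sqr_ge0// ltW.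
have KB0 w : setT w -> (0 <= (K * \1_B w)%:E)%E.
  by move=> _; rewrite lee_fin mulr_ge0// ltW.
have mEL2 : measurable_fun setT (fun w => ((4 * K)^-1 * L w ^+ 2)%:E).
  exact/measurable_EFinP.
have mKB : measurable_fun setT (fun w => (K * \1_B w)%:E).
  by apply/measurable_EFinP/measurable_funM => //; exact: measurable_indic.
rewrite (ge0_integralD _ measurableT L20 mEL2 KB0 mKB).
have -> : (\int[P]_w (K * \1_B w)%:E = K%:E * P B)%E.
  under eq_integral do rewrite EFinM.
  rewrite ge0_integralZl_EFin ?(ltW K0)// ?integral_indic ?setIT//.
  exact/measurable_EFinP/measurable_indic.
have -> : (\int[P]_w ((4 * K)^-1 * L w ^+ 2)%:E =
    (4 * K)^-1%:E * (\prod_(i < n) \int[N]_y (l i y ^+ 2))%:E)%E.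
  rewrite -iL2; under eq_integral do rewrite EFinM.
  rewrite ge0_integralZl_EFin ?(ltW K40)//.
    by move=> w _; rewrite lee_fin sqr_ge0.
  exact/measurable_EFinP/measurable_funX.
have : P B \is a fin_num by exact: fin_num_measure.
case: (P B) => [b| |]//.
rewrite -!EFinM -EFinD !lee_fin => _ hb.
have h2 : (4 * K)^-1 * \prod_(i < n) \int[N]_y (l i y ^+ 2) <= 4^-1.
  rewrite -[leRHS](_ : (4 * K)^-1 * K = _) ?ler_wpM2l ?(ltW K40)//.
  by field; rewrite gt_eqF.
have h3 : 4^-1 <= K * b by lra.
by rewrite invfM ler_pdivrMr// mulrC.
Qed.

End WeightedChebyshev.

(** * Gaussian integrals *)

Section GaussianIntegral.
Context {R : realType}.
Local Notation N := (normal_prob (0 : R) 1).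
Local Notation leb := (@lebesgue_measure R).
Implicit Types (f g : R -> R) (s t x : R).

Lemma ge0_integral_normal f : measurable_fun setT f -> (forall x, 0 <= f x) ->
  (\int[N]_x (f x)%:E = \int[leb]_x (normal_pdf 0 1 x * f x)%:E)%E.
Proof.
move=> mf f0.
rewrite (@ge0_integral_density _ _ _ _ _ leb N (normal_pdf 0 1) id 1)//.
- by rewrite mul1e.
- exact: measurable_normal_pdf.
- by move=> x; exact: normal_pdf_ge0.
- move=> B mB; rewrite mul1e.
  rewrite -[RHS]/(\int[leb]_(x in B) (normal_pdf 0 1 x)%:E)%E [RHS]integral_mkcond.
  apply: eq_integral => x _; rewrite patchE indicE.
  by case: ifP => _; rewrite ?mulr1 ?mulr0.
Qed.

(* The density of N(t, s^2) with respect to N(0, 1). *)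
Definition tilt t s x := s^-1 * expR (x ^+ 2 / 2 - (x - t) ^+ 2 / (2 * s ^+ 2)).

Lemma tilt_ge0 t s x : 0 <= s -> 0 <= tilt t s x.
Proof. by move=> s0; rewrite mulr_ge0 ?invr_ge0 ?expR_ge0. Qed.

Lemma continuous_tilt t s : continuous (tilt t s).
Proof.
move=> x; apply: cvgM; first exact: cvg_cst.
apply: (cvg_comp _ expR); last exact: continuous_expR.
apply: (@cvgB _ R^o); apply: cvgM; try exact: cvg_cst.
  exact: exprn_continuous.
apply: (cvg_comp (fun x => x - t) (fun x => x ^+ 2)); last exact: exprn_continuous.
by apply: (@cvgB _ R^o); [exact: cvg_id|exact: cvg_cst].
Qed.

Lemma integral_normal_affine t s f : 0 < s -> continuous f -> (forall x, 0 <= f x) ->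
  (\int[N]_x (f (t + s * x))%:E = \int[N]_x (f x * tilt t s x)%:E)%E.
Proof.
move=> s0 cf f0; pose F x := t + s * x : R^o.
have cF : continuous F.
  move=> x; apply: (@cvgD _ R^o); first exact: cvg_cst.
  by apply: cvgM; [exact: cvg_cst|exact: cvg_id].
have dF x : is_derive x 1 F s.
  rewrite /F; apply: is_derive_eq.
  by rewrite add0r mul1r -[LHS]/(s * 1) mulr1.
have F'E : (F^`())%classic = cst s.
  by apply/funext => x; rewrite derive1E; exact: derive_val.
have cG : continuous (fun x => normal_pdf 0 1 x * (f x * tilt t s x)).
  move=> x; apply: cvgM; first exact: continuous_normal_pdf.
  by apply: cvgM; [exact: cf|exact: continuous_tilt].
have cfF : continuous (fun x => f (t + s * x)).
  by move=> x; apply: continuous_comp; [exact: cF|exact: cf].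
have cft : continuous (fun x => f x * tilt t s x).
  by move=> x; apply: cvgM; [exact: cf|exact: continuous_tilt].
have ft0 x : 0 <= f x * tilt t s x by rewrite mulr_ge0// tilt_ge0// ltW.
rewrite (ge0_integral_normal (continuous_measurable_fun cfF))//.
rewrite (ge0_integral_normal (continuous_measurable_fun cft))//.
rewrite [RHS](@increasing_ge0_integration_by_substitutionT _ F)//.
- apply: eq_integral => x _; congr (_%:E).
  rewrite F'E /F /cst /= !fctE /tilt !normal_pdfE ?oner_neq0// /normal_fun.
  rewrite !subr0 expr1n; set z := t + s * x.
  have -> : expR (- x ^+ 2 / 2) =
      expR (- z ^+ 2 / 2) * expR (z ^+ 2 / 2 - (z - t) ^+ 2 / (2 * s ^+ 2)).
    by rewrite -expRD; congr expR; rewrite /z; field; rewrite gt_eqF.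
  by field; rewrite gt_eqF.
- by move=> x y xy; rewrite /F ltrD2l ltr_pM2l.
- by rewrite F'E => ?; exact: cvg_cst.
- by rewrite F'E; exact: is_cvg_cst.
- by rewrite F'E; exact: is_cvg_cst.
- apply: (cvg_comp (fun x => s * x) (fun x => t + x)); last exact: cvg_addrl_Ny.
  by apply: gt0_cvgMrNy => //; exact: cvg_id.
- apply: (cvg_comp (fun x => s * x) (fun x => t + x)); last exact: cvg_addrl.
  by apply: gt0_cvgMry => //; exact: cvg_id.
- by move=> x; rewrite mulr_ge0 ?normal_pdf_ge0.
Qed.

End GaussianIntegral.

(** * Continuous functions of at most exponential growth *)

Section Tame.
Context {R : realType}.
Local Notation N := (normal_prob (0 : R) 1).
Local Notation leb := (@lebesgue_measure R).
Implicit Types (f g : R -> R) (s t x p : R).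

(** The reflection is not an increasing substitution, so it is handled through the invariance of
    Lebesgue measure under negation. *)
Lemma integral_normal_opp f : continuous f -> (forall x, 0 <= f x) ->
  (\int[N]_x (f (- x))%:E = \int[N]_x (f x)%:E)%E.
Proof.
move=> cf f0.
have cN : continuous (-%R : R -> R) by move=> x; apply: (@cvgN _ R^o); exact: cvg_id.
have mf : measurable_fun setT f by exact: continuous_measurable_fun.
have mfN : measurable_fun setT (fun x => f (- x)).
  by apply: continuous_measurable_fun => x; apply: continuous_comp; [exact: cN|exact: cf].
rewrite (ge0_integral_normal mfN)// (ge0_integral_normal mf)//.
pose g x := (normal_pdf 0 1 x * f x)%:E.
have mg : measurable_fun setT g.
  by apply/measurable_EFinP/measurable_funM => //; exact: measurable_normal_pdf.
transitivity (\int[pushforward leb (-%R : _ -> measurableTypeR R)]_x g x)%E.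
  rewrite ge0_integral_pushforward.
  - apply: eq_integral => x _; congr (_%:E); congr (_ * _).
    by rewrite !normal_pdfE ?oner_neq0// /normal_fun !subr0 sqrrN.
  - exact: continuous_measurable_fun cN.
  - exact: measurableT.
  - exact: mg.
  - by move=> x _; rewrite lee_fin mulr_ge0 ?normal_pdf_ge0.
by apply: eq_measure_integral => A mA _; exact: lebesgue_measureN.
Qed.

(** At 0, where [|x|^p] is not differentiable if [p <= 1], the modulus of continuity [e^(1/p)] is
    explicit. Elsewhere continuity follows from differentiability of the power on the positive
    half-line. *)
Lemma continuous_normr_powR p : 0 < p -> continuous (fun x => `|x| `^ p).
Proof.
move=> p0 x; have [->|x0] := eqVneq x 0.
  apply/cvgrPdist_lt => e e0.
  rewrite normr0 powR0 ?gt_eqF//; near=> y.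
  rewrite sub0r normrN ger0_norm ?powR_ge0//.
  have -> : e = (e `^ p^-1) `^ p by rewrite -powRrM mulVf ?gt_eqF// powRr1// ltW.
  apply: gt0_ltr_powR => //; rewrite ?nnegrE ?powR_ge0//.
  near: y; apply/nbhs_ballP; exists (e `^ p^-1); first exact: powR_gt0.
  by move=> y; rewrite /ball/= sub0r normrN.
have nx0 : 0 < `|x| by rewrite normr_gt0.
apply: (cvg_comp (fun x => `|x|) (fun y => y `^ p)); first exact: (@norm_continuous _ R^o).
have dp : derivable (fun y : R^o => y `^ p : R^o) `|x| 1.
  by case: (@is_derive1_powR R p _ nx0).
have cp : {for `|x|, continuous (fun y : R^o => y `^ p : R^o)}.
  exact/differentiable_continuous/derivable1_diffP.
exact: cp.
Unshelve. all: by end_near. Qed.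

(** A class closed under sums and products whose members are all integrable for N(0, 1). The growth
    allowed is exponential, not polynomial, because [cosh (t x)] and the density ratio of N(t, 1)
    occur in the integrands. *)
Definition tame f := continuous f /\
  exists K k : R, [/\ 0 <= K, 0 <= k & forall x, `|f x| <= K * expR (k * `|x|)].

Lemma tame_cst c : tame (fun=> c).
Proof.
split; first by move=> x; exact: cvg_cst.
exists `|c|, 0; split=> // x; by rewrite mul0r expR0 mulr1.
Qed.

Lemma tameD f g : tame f -> tame g -> tame (fun x => f x + g x).
Proof.
move=> [cf [K [k [K0 k0 fK]]]] [cg [M [m [M0 m0 gM]]]]; split.
  by move=> x; apply: (@cvgD _ R^o); [exact: cf|exact: cg].
exists (K + M), (k + m); split; rewrite ?addr_ge0// => x.
rewrite (le_trans (ler_normD _ _))// mulrDl lerD//.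
- rewrite (le_trans (fK x))// ler_wpM2l// ler_expR ler_wpM2r//; lra.
- rewrite (le_trans (gM x))// ler_wpM2l// ler_expR ler_wpM2r//; lra.
Qed.

Lemma tameM f g : tame f -> tame g -> tame (fun x => f x * g x).
Proof.
move=> [cf [K [k [K0 k0 fK]]]] [cg [M [m [M0 m0 gM]]]]; split.
  by move=> x; apply: cvgM; [exact: cf|exact: cg].
exists (K * M), (k + m); split; rewrite ?addr_ge0 ?mulr_ge0// => x.
by rewrite normrM mulrDl expRD mulrACA ler_pM.
Qed.

Lemma tameX f n : tame f -> tame (fun x => f x ^+ n).
Proof.
move=> tf; elim: n => [|n IH]; first exact: tame_cst.
under eq_fun do rewrite exprS; exact: tameM.
Qed.

Lemma tame_id : tame id.
Proof.
split; first by move=> x; exact: cvg_id.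
exists 1, 1; split=> // x; rewrite !mul1r.
by have := expR_ge1Dx `|x|; lra.
Qed.

Lemma tame_affine t s : tame (fun x => t + s * x).
Proof. by apply: tameD; [|apply: tameM]; try exact: tame_cst; exact: tame_id. Qed.

Lemma tame_expR a : tame (fun x => expR (a * x)).
Proof.
split.
  move=> x; apply: continuous_comp; last exact: continuous_expR.
  by apply: cvgM; [exact: cvg_cst|exact: cvg_id].
exists 1, `|a|; split=> // x; rewrite mul1r ger0_norm ?expR_ge0//.
by rewrite ler_expR -normrM ler_norm.
Qed.

Lemma powR_expR_le p y : 0 <= p -> 0 <= y -> y `^ p <= expR (p * y).
Proof.
move=> p0 y0; rewrite mulrC expRM ge0_ler_powR// ?nnegrE ?expR_ge0//.
by have := expR_ge1Dx y; lra.
Qed.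

Lemma tame_powR t s p : 0 < p -> tame (fun x => `|t + s * x| `^ p).
Proof.
move=> p0; split.
  have [cf _] := tame_affine t s.
  move=> x; apply: (cvg_comp (fun x => t + s * x) (fun y => `|y| `^ p)); first exact: cf.
  exact: continuous_normr_powR.
exists (expR (p * `|t|)), (p * `|s|); split; rewrite ?expR_ge0 ?mulr_ge0 ?(ltW p0)// => x.
rewrite ger0_norm ?powR_ge0// -expRD (le_trans (powR_expR_le (ltW p0) _))// ler_expR.
by rewrite -mulrA -mulrDr ler_pM2l// (le_trans (ler_normD _ _))// normrM.
Qed.

(** For [s <= 1] the exponent [(1 - 1/s^2) x^2 / 2] is nonpositive and the ratio is bounded by
    [1/s]; for [s > 1] it would grow like a Gaussian exponential and leave the class. *)
Lemma tame_tilt s : 0 < s <= 1 -> tame (tilt 0 s).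
Proof.
move=> /andP[s0 s1]; split; first exact: continuous_tilt.
exists s^-1, 0; split; rewrite ?invr_ge0 ?(ltW s0)// => x.
rewrite ger0_norm ?tilt_ge0 ?(ltW s0)// /tilt mul0r expR0 mulr1.
rewrite ler_piMr ?invr_ge0 ?(ltW s0)// -expR0 ler_expR subr0 subr_le0.
rewrite ler_wpM2l ?sqr_ge0// lef_pV2 ?posrE ?mulr_gt0 ?exprn_gt0//.
by rewrite ler_piMr// expr_le1// ltW.
Qed.

(** Completing the square, [exp (k x)] is [exp (k^2 / 2)] times the density ratio of N(k, 1), which
    integrates to 1. *)
Lemma integrable_expR k : N.-integrable setT (EFin \o (fun x => expR (k * x))).
Proof.
have [ce _] := tame_expR k.
have me := continuous_measurable_fun ce.
apply/integrableP; split; first exact/measurable_EFinP.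
under eq_integral do rewrite /= ger0_norm ?expR_ge0//.
have h := @integral_normal_affine R k 1 (fun=> 1) ltr01 (fun=> cvg_cst _) (fun=> ler01).
have -> : (\int[N]_x (expR (k * x))%:E =
    \int[N]_x ((expR (k ^+ 2 / 2))%:E * (1 * tilt k 1 x)%:E))%E.
  apply: eq_integral => x _; rewrite -EFinM; congr (_%:E).
  by rewrite /tilt invr1 !mul1r -expRD; congr expR; field.
rewrite ge0_integralZl_EFin ?expR_ge0//.
- by rewrite -h integral_cst//= probability_setT mule1 -EFinM ltry.
- by move=> x _; rewrite mul1r lee_fin tilt_ge0.
- apply/measurable_EFinP/measurable_funM => //.
  exact: continuous_measurable_fun (@continuous_tilt _ _ _).
Qed.

Lemma tame_integrable f : tame f -> N.-integrable setT (EFin \o f).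
Proof.
move=> [cf [K [k [K0 k0 fK]]]]; have mf := continuous_measurable_fun cf.
have iK : N.-integrable setT (EFin \o (fun x => K * (expR (k * x) + expR (- k * x)))).
  have -> : EFin \o (fun x => K * (expR (k * x) + expR (- k * x))) =
      (fun x => K%:E * ((EFin \o (fun x => expR (k * x)))%R \+
        (EFin \o (fun x => expR (- k * x)))) x)%E.
    by apply/funext => x /=; rewrite EFinM EFinD.
  apply: integrableZl => //; apply: integrableD => //; exact: integrable_expR.
apply: le_integrable iK => //; first exact/measurable_EFinP.
move=> x _; rewrite /= lee_fin (le_trans (fK x))//.
rewrite [leRHS]ger0_norm ?mulr_ge0 ?addr_ge0 ?expR_ge0// ler_wpM2l//.
have [x0|x0] := leP 0 x.
  by rewrite ger0_norm// lerDl expR_ge0.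
by rewrite ltr0_norm// mulrN mulNr lerDr expR_ge0.
Qed.

End Tame.

(** * Expectations under the standard normal law *)

Section GaussianExpectation.
Context {R : realType}.
Local Notation N := (normal_prob (0 : R) 1).
Implicit Types (f g : R -> R) (s t x p : R).

Definition gauss f := \int[N]_x f x.

Lemma gaussD f g : tame f -> tame g ->
  gauss (fun x => f x + g x) = gauss f + gauss g.
Proof. by move=> tf tg; rewrite /gauss RintegralD//; exact: tame_integrable. Qed.

Lemma gaussZ c f : tame f -> gauss (fun x => c * f x) = c * gauss f.
Proof. by move=> tf; rewrite /gauss RintegralZl//; exact: tame_integrable. Qed.

Lemma gauss_cst c : gauss (fun=> c) = c.
Proof. by rewrite /gauss Rintegral_cst//= probability_setT mulr1. Qed.

Lemma gauss_le f g : tame f -> tame g -> (forall x, f x <= g x) ->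
  gauss f <= gauss g.
Proof. by move=> tf tg fg; apply: le_Rintegral => //; exact: tame_integrable. Qed.

Lemma gauss_ge0 f : (forall x, 0 <= f x) -> 0 <= gauss f.
Proof. by move=> f0; exact: Rintegral_ge0. Qed.

Lemma gauss_opp f : tame f -> (forall x, 0 <= f x) ->
  gauss (fun x => f (- x)) = gauss f.
Proof. by move=> [cf _] f0; rewrite /gauss /Rintegral integral_normal_opp. Qed.

Lemma gauss_affine t s f : 0 < s -> tame f -> (forall x, 0 <= f x) ->
  gauss (fun x => f (t + s * x)) = gauss (fun x => f x * tilt t s x).
Proof. by move=> s0 [cf _] f0; rewrite /gauss /Rintegral integral_normal_affine. Qed.

(** Two zeros [r] and [- r] are allowed with a view to two integrands: [|x|^p], with [r = 0], and
    the product [w] in the lower moment bound. A finite set is null for a law dominated by Lebesgue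
    measure, so a zero integral would make the whole line null. *)
Lemma gauss_gt0 f r : tame f -> (forall x, 0 <= f x) ->
  (forall x, f x = 0 -> x = r \/ x = - r) -> 0 < gauss f.
Proof.
move=> tf f0 fr; rewrite lt_neqAle gauss_ge0// andbT; apply/negP => /eqP g0.
have mf : measurable_fun setT (EFin \o f).
  by apply/measurable_EFinP; apply: continuous_measurable_fun; exact: tf.1.
have int0 : (\int[N]_x `|(EFin \o f) x| = 0)%E.
  under eq_integral do rewrite /= ger0_norm//.
  have fin : (\int[N]_x (f x)%:E)%E \is a fin_num.
    exact: (integrable_fin_num measurableT (tame_integrable tf)).
  by rewrite -(fineK fin) -[fine _]/(gauss f) -g0.
have [A [mA NA sA]] := (ae_eq_integral_abs N measurableT mf).1 int0.
pose B : set R := [set r; - r].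
have mB : measurable B by apply: measurableU; exact: measurable_set1.
have NB : N B = 0%E.
  have /null_content_dominatesP := @normal_prob_dominates R 0 1.
  move=> /(_ _ mB); apply; apply: countable_lebesgue_measure0.
  by apply: finite_set_countable; rewrite /B finite_setU; split; exact: finite_set1.
have : (N setT <= N (B `|` A))%E.
  apply: le_measure; rewrite ?inE//; first exact: measurableU.
  move=> x _; have [fx|fx] := eqVneq (f x) 0.
    by left; case: (fr _ fx) => ->; [left|right].
  by right; apply: sA => /= /(_ Logic.I) [fx0]; rewrite fx0 eqxx in fx.
rewrite probability_setT measureU0//.
by move=> h; have : (1 <= N B)%E := h; rewrite NB lee_fin ler10.
Qed.

End GaussianExpectation.

(** * Shifted absolute moments *)

Section AbsoluteMoments.
Context {R : realType}.
Implicit Types (f g : R -> R) (s t x y p q : R).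

Definition coshR y : R := (expR y + expR (- y)) / 2.

Lemma coshRN y : coshR (- y) = coshR y.
Proof. by rewrite /coshR opprK addrC. Qed.

Lemma coshR_normr y : coshR `|y| = coshR y.
Proof. by have [y0|y0] := leP 0 y; [rewrite ger0_norm|rewrite ltr0_norm// coshRN]. Qed.

Lemma coshR_ge0 y : 0 <= coshR y.
Proof. by rewrite divr_ge0// addr_ge0// expR_ge0. Qed.

Lemma expR_sub_expRN_ge y : 0 <= y -> y <= expR y - expR (- y).
Proof.
move=> y0; have h1 := expR_ge1Dx y.
have : expR (- y) <= 1 by rewrite expR_le1 oppr_le0.
by lra.
Qed.

Lemma expR_sub_expRN_le y : 0 <= y -> expR y - expR (- y) <= 2 * y * expR y.
Proof.
move=> y0; have h : 1 - 2 * y <= expR (- (2 * y)) by have := expR_ge1Dx (- (2 * y)); lra.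
have -> : expR (- y) = expR y * expR (- (2 * y)) by rewrite -expRD; congr expR; ring.
have e0 := expR_ge0 y.
suff : expR y * (1 - 2 * y) <= expR y * expR (- (2 * y)) by lra.
by rewrite ler_wpM2l.
Qed.

(** The formula [cosh a - cosh b = 2 sinh ((a + b) / 2) sinh ((a - b) / 2)], which turns the
    preceding bounds on [expR y - expR (- y)] into bounds on differences of [cosh]. *)
Lemma coshR_sub a b : coshR a - coshR b =
  (expR ((a + b) / 2) - expR (- ((a + b) / 2))) *
  (expR ((a - b) / 2) - expR (- ((a - b) / 2))) / 2.
Proof.
have e u v : expR u * expR v = expR (u + v) by rewrite expRD.
rewrite mulrBl !mulrBr !e /coshR.
have -> : (a + b) / 2 + (a - b) / 2 = a by field.
have -> : (a + b) / 2 + - ((a - b) / 2) = b by field.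
have -> : - ((a + b) / 2) + (a - b) / 2 = - b by field.
have -> : - ((a + b) / 2) + - ((a - b) / 2) = - a by field.
by field.
Qed.

(** Each factor of the product formula is at least its argument. The optimal constant would be 1/2;
    1/8 suffices to compare [cosh (t x) - cosh (t r)] with [t^2 (x^2 - r^2)]. *)
Lemma coshR_sub_ge a b : `|b| <= `|a| -> (a ^+ 2 - b ^+ 2) / 8 <= coshR a - coshR b.
Proof.
move=> ba; rewrite -(coshR_normr a) -(coshR_normr b).
rewrite -(real_normK (num_real a)) -(real_normK (num_real b)).
move: (normr_ge0 a) (normr_ge0 b) ba; move: `|a| `|b| => {}a {}b a0 b0 ba.
rewrite coshR_sub.
have h1 : (a + b) / 2 <= expR ((a + b) / 2) - expR (- ((a + b) / 2)).
  by apply: expR_sub_expRN_ge; lra.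
have h2 : (a - b) / 2 <= expR ((a - b) / 2) - expR (- ((a - b) / 2)).
  by apply: expR_sub_expRN_ge; lra.
have : (a + b) / 2 * ((a - b) / 2) <=
  (expR ((a + b) / 2) - expR (- ((a + b) / 2))) *
  (expR ((a - b) / 2) - expR (- ((a - b) / 2))).
  by apply: ler_pM => //; lra.
by move: (_ * (expR _ - _)) => z; lra.
Qed.

Lemma coshR_sub1_le y : coshR y - 1 <= y ^+ 2 / 2 * expR `|y|.
Proof.
rewrite -coshR_normr -(real_normK (num_real y)); move: (normr_ge0 y); move: `|y| => {}y y0.
have -> : coshR y - 1 = coshR y - coshR 0 by rewrite [coshR 0]/coshR oppr0 expR0; field.
rewrite coshR_sub addr0 subr0.
have h := @expR_sub_expRN_le (y / 2) ltac:(lra).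
have h1 : 0 <= expR (y / 2) - expR (- (y / 2)).
  by have := @expR_sub_expRN_ge (y / 2) ltac:(lra); lra.
have := ler_pM h1 h1 h h.
have -> : 2 * (y / 2) * expR (y / 2) * (2 * (y / 2) * expR (y / 2)) =
   y ^+ 2 * (expR (y / 2) * expR (y / 2)) by field.
rewrite -expRD -splitr => hz.
by rewrite [leRHS]mulrAC ler_pM2r ?invr_gt0.
Qed.

Lemma tilt1E t x : tilt t 1 x = expR (- (t ^+ 2 / 2)) * expR (t * x).
Proof. by rewrite /tilt invr1 mul1r -expRD; congr expR; field. Qed.

Lemma tame_tilt1 t : tame (tilt t 1).
Proof.
rewrite (_ : tilt t 1 = fun x => expR (- (t ^+ 2 / 2)) * expR (t * x)).
  by apply: tameM; [exact: tame_cst|exact: tame_expR].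
by apply/funext => x; exact: tilt1E.
Qed.

Lemma tame_coshR t : tame (fun x => coshR (t * x)).
Proof.
rewrite /coshR; apply: tameM; last exact: tame_cst.
apply: tameD; first exact: tame_expR.
under eq_fun do rewrite -mulNr; exact: tame_expR.
Qed.

(* Averaging the density of N(t, 1) over [x] and [- x] turns [exp (t x)] into [cosh]. *)
Lemma gauss_shift t f : tame f -> (forall x, 0 <= f x) -> (forall x, f (- x) = f x) ->
  gauss (fun x => f (t + 1 * x)) =
  expR (- (t ^+ 2 / 2)) * gauss (fun x => f x * coshR (t * x)).
Proof.
move=> tf f0 fN; rewrite gauss_affine//.
pose h x := f x * tilt t 1 x.
have th : tame h by apply: tameM => //; exact: tame_tilt1.
have thN : tame (fun x => h (- x)).
  have -> : (fun x => h (- x)) = fun x => f x * tilt (- t) 1 x.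
    by apply/funext => x; rewrite /h fN !tilt1E sqrrN mulrN mulNr.
  by apply: tameM => //; exact: tame_tilt1.
have h0 x : 0 <= h x by rewrite mulr_ge0// tilt_ge0.
have -> : gauss h = 2^-1 * gauss (fun x => h x + h (- x)).
  by rewrite gaussD// gauss_opp//; field.
rewrite -!gaussZ; last 2 first.
- exact: tameD.
- by apply: tameM => //; exact: tame_coshR.
congr gauss; apply/funext => x; rewrite /h fN !tilt1E /coshR mulrN.
by field.
Qed.

Lemma tame_abs p : 0 < p -> tame (fun x => `|x| `^ p).
Proof.
move=> p0; have := @tame_powR R 0 1 _ p0.
by under eq_fun do rewrite add0r mul1r.
Qed.

Definition mu p := gauss (fun x : R => `|x| `^ p).

Lemma mu_ge0 p : 0 <= mu p.
Proof. by apply: gauss_ge0 => x; exact: powR_ge0. Qed.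

Definition gfun p t : R := if `|t| <= 1 then t ^+ 2 else `|t| `^ p.

Lemma gfun_ge0 p t : 0 <= gfun p t.
Proof. by rewrite /gfun; case: ifP => _; rewrite ?sqr_ge0 ?powR_ge0. Qed.

Lemma gfun_mono p q t : p <= q -> gfun p t <= gfun q t.
Proof.
by move=> pq; rewrite /gfun; case: (leP `|t| 1) => // /ltW t1; rewrite ler_powR.
Qed.

(** The argument [x + y <= 2 max x y] treats convex and concave powers alike. *)
Lemma powR_add_le p x y : 0 < p -> 0 <= x -> 0 <= y ->
  (x + y) `^ p <= 2 `^ p * (x `^ p + y `^ p).
Proof.
move=> p0 x0 y0; rewrite mulrDr -!powRM//.
have nn (z : R) : 0 <= z -> z \in Num.nneg by rewrite nnegrE.
have [xy|yx] := leP x y.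
- rewrite (le_trans (_ : _ <= (2 * y) `^ p))//; last by rewrite lerDr powR_ge0.
  by apply: ge0_ler_powR; rewrite ?nn ?(ltW p0)//; lra.
- rewrite (le_trans (_ : _ <= (2 * x) `^ p))//; last by rewrite lerDl powR_ge0.
  by apply: ge0_ler_powR; rewrite ?nn ?(ltW p0)//; lra.
Qed.

Lemma gauss_abs_le p s t : 0 < p -> 0 < s <= 1 ->
  forall x, `|t + s * x| `^ p <= 2 `^ p * (`|t| `^ p + `|x| `^ p).
Proof.
move=> p0 /andP[s0 s1] x; rewrite (le_trans _ (powR_add_le _ _ _))//.
apply: ge0_ler_powR; rewrite ?nnegrE ?addr_ge0 ?(ltW p0)//.
rewrite (le_trans (ler_normD _ _))// lerD2l normrM ger0_norm ?(ltW s0)//.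
by rewrite ler_piMl.
Qed.

(** For [|t| <= 1] the symmetrised shift leaves [cosh (t x) - 1], which is at most [t^2] times an
    integrable function independent of [t]. For [|t| > 1] the crude bound by [|t|^p + |x|^p] is
    already of the right order. *)
Lemma gauss_abs_upper p : 0 < p ->
  exists2 C, 0 < C & forall t, gauss (fun x => `|t + 1 * x| `^ p) <= mu p + C * gfun p t.
Proof.
move=> p0; have tp := tame_abs p0.
pose w x := `|x| `^ p * (x ^+ 2 * (expR (1 * x) + expR (-1 * x))).
have tw : tame w.
  apply: tameM => //; apply: tameM; first by apply: tameX; exact: tame_id.
  by apply: tameD; exact: tame_expR.
have w0 x : 0 <= w x by rewrite mulr_ge0 ?powR_ge0// mulr_ge0 ?sqr_ge0// addr_ge0 ?expR_ge0.
have gw0 := gauss_ge0 w0; have m0 := mu_ge0 p.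
have p20 : 0 < 2 `^ p :> R by exact: powR_gt0.
(* The part [gauss w] serves [|t| <= 1], and the part with [2 ^ p] serves [|t| > 1]. *)
exists (1 + gauss w + 2 `^ p * (1 + mu p)).
  by rewrite ltr_wpDr// ?mulr_ge0 ?ltr_wpDr ?addr_ge0 ?(ltW p20).
move=> t; rewrite /gfun; case: (leP `|t| 1) => t1; last first.
  have tp1 : 1 <= `|t| `^ p by rewrite -(powRr0 `|t|) ler_powR ?ltW.
  apply: (@le_trans _ _ (gauss (fun x => 2 `^ p * (`|t| `^ p + `|x| `^ p)))).
    apply: gauss_le.
    - exact: tame_powR.
    - by apply: tameM; [exact: tame_cst|apply: tameD => //; exact: tame_cst].
    - by apply: gauss_abs_le => //; rewrite ltr01 lexx.
  rewrite gaussZ; last by apply: tameD => //; exact: tame_cst.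
  rewrite gaussD//; last exact: tame_cst.
  rewrite gauss_cst -/(mu p).
  have : 2 `^ p * (`|t| `^ p + mu p) <= 2 `^ p * ((1 + mu p) * `|t| `^ p).
    by rewrite ler_wpM2l ?(ltW p20)// mulrDl mul1r lerD2l ler_peMr.
  have : 0 <= (1 + gauss w) * `|t| `^ p by rewrite mulr_ge0 ?powR_ge0// addr_ge0.
  by move: m0; lra.
have pN x : `|- x| `^ p = `|x| `^ p by rewrite normrN.
rewrite (gauss_shift t tp (fun x => powR_ge0 _ _) pN).
have tch := tameM tp (tame_coshR t).
have gch0 : 0 <= gauss (fun x => `|x| `^ p * coshR (t * x)).
  by apply: gauss_ge0 => x; rewrite mulr_ge0 ?powR_ge0 ?coshR_ge0.
apply: (@le_trans _ _ (gauss (fun x => `|x| `^ p * coshR (t * x)))).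
  by rewrite ler_piMl// expR_le1 oppr_le0 divr_ge0 ?sqr_ge0.
apply: (@le_trans _ _ (gauss (fun x => `|x| `^ p + t ^+ 2 * w x))).
  apply: gauss_le => //; first by apply: tameD => //; apply: tameM => //; exact: tame_cst.
  move=> x; rewrite (_ : _ + _ = `|x| `^ p *
      (1 + t ^+ 2 * (x ^+ 2 * (expR (1 * x) + expR (-1 * x))))); last by rewrite /w; ring.
  rewrite ler_wpM2l ?powR_ge0//.
  have h := @coshR_sub1_le (t * x).
  suff : (t * x) ^+ 2 / 2 * expR `|t * x| <= t ^+ 2 * (x ^+ 2 * (expR (1 * x) + expR (-1 * x))).
    by lra.
  rewrite (_ : _ / 2 * _ = t ^+ 2 * (x ^+ 2 * (expR `|t * x| / 2))); last by field.
  rewrite ler_wpM2l ?sqr_ge0// ler_wpM2l ?sqr_ge0//.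
  have e1 : expR `|t * x| <= expR `|x| by rewrite ler_expR normrM ler_piMl.
  have e2 : expR `|x| <= expR (1 * x) + expR (-1 * x).
    rewrite mul1r mulN1r; have [x0|x0] := leP 0 x.
      by rewrite ger0_norm// lerDl expR_ge0.
    by rewrite ltr0_norm// lerDr expR_ge0.
  by have := expR_ge0 `|x|; lra.
rewrite gaussD//; last by apply: tameM => //; exact: tame_cst.
rewrite gaussZ// -/(mu p) lerD2l mulrC ler_wpM2r ?sqr_ge0//.
by have := mulr_ge0 (ltW p20) (addr_ge0 ler01 m0); lra.
Qed.

End AbsoluteMoments.

(** * Lower bounds for shifted absolute moments *)

Section LowerMoments.
Context {R : realType}.
Implicit Types (f g : R -> R) (s t x y p q : R).
Local Notation mu := (@mu R).
Local Notation gfun := (@gfun R).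

Lemma powR_invK q x : 0 < q -> 0 <= x -> (x `^ q^-1) `^ q = x.
Proof. by move=> q0 x0; rewrite -powRrM mulVf ?gt_eqF// powRr1. Qed.

Lemma powR_le_inv q x y : 0 < q -> 0 <= x -> 0 <= y -> (x `^ q <= y `^ q) = (x <= y).
Proof.
move=> q0 x0 y0; apply/idP/idP; last first.
  by move=> xy; apply: ge0_ler_powR; rewrite ?nnegrE ?(ltW q0).
by apply: contraTT; rewrite -!ltNge => xy; apply: gt0_ltr_powR; rewrite ?nnegrE.
Qed.

Lemma powR_le_root q x y : 0 < q -> 0 <= x -> 0 <= y ->
  (x `^ q <= y) = (x <= y `^ q^-1).
Proof.
by move=> q0 x0 y0; rewrite -{1}(powR_invK q0 y0) powR_le_inv ?powR_ge0.
Qed.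

Lemma mu_gt0 p : 0 < p -> 0 < mu p.
Proof.
move=> p0; apply: (@gauss_gt0 _ _ 0).
- exact: tame_abs.
- by move=> x; exact: powR_ge0.
- by move=> x /powR_eq0_eq0/normr0_eq0 ->; left.
Qed.

Lemma normr_le_addB t x : `|t| <= `|t + x| \/ `|t| <= `|t - x|.
Proof.
have := ler_normD (t + x) (t - x); rewrite (_ : t + x + (t - x) = 2 * t); last by ring.
rewrite normrM ger0_norm//; have [h _|h1 h2] := leP `|t| `|t + x|; first by left.
by right; lra.
Qed.

(** Pairing [x] with [- x]: one of [|t + x|] and [|t - x|] is at least [|t|], so the two powers add
    up to at least [|t|^q], convex or not. *)
Lemma gauss_abs_ge q t : 0 < q -> `|t| `^ q / 2 <= gauss (fun x => `|t + 1 * x| `^ q).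
Proof.
move=> q0; pose h x := `|t + 1 * x| `^ q; rewrite -/h.
have th : tame h by exact: tame_powR.
have h0 x : 0 <= h x by exact: powR_ge0.
have thN : tame (fun x => h (- x)).
  by rewrite /h; under eq_fun do rewrite mulrN -mulNr; exact: tame_powR.
have thh := tameD th thN.
have E : gauss (fun x => h x + h (- x)) = gauss h * 2.
  by rewrite gaussD// (gauss_opp th h0) mulr_natr mulr2n.
rewrite ler_pdivrMr// -E -[leLHS]gauss_cst.
apply: gauss_le => [|//|x]; first exact: tame_cst.
by case: (normr_le_addB t x) => tx; [apply: ler_wpDr|apply: ler_wpDl] => //;
  rewrite /h mul1r powR_le_inv.
Qed.

(** Up to a level [T] for [|t|], correlation with [cosh (t x)] yields a gain of order [t^2], and
    [gfun q t] is at most [T^q t^2] there. Beyond [T], half of [|t|^q] already outweighs [mu q]. *)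
Lemma gauss_abs_lower q : 0 < q ->
  exists2 c, 0 < c & forall t, mu q + c * gfun q t <= gauss (fun x => `|t + 1 * x| `^ q).
Proof.
move=> q0; have m0 := mu_gt0 q0; set m := mu q in m0 *.
pose r := m `^ q^-1; have r0 : 0 <= r by exact: powR_ge0.
have rq : r `^ q = m by rewrite powR_invK// ltW.
have tq := tame_abs q0.
(* Both factors change sign exactly at [|x| = r], so the product is nonnegative and vanishes only at
   [r] and [- r]. *)
pose w x := (`|x| `^ q - m) * (x ^+ 2 - r ^+ 2).
have tqm : tame (fun x => `|x| `^ q - m) by apply: tameD => //; exact: tame_cst.
have tw : tame w.
  apply: tameM => //; apply: tameD; last exact: tame_cst.
  by apply: tameX; exact: tame_id.
have sgn x : (m <= `|x| `^ q) = (r <= `|x|) by rewrite -rq powR_le_inv.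
have sgn' x : (`|x| `^ q <= m) = (`|x| <= r) by rewrite -rq powR_le_inv.
have x2 x : x ^+ 2 = `|x| ^+ 2 by rewrite real_normK ?num_real.
have w0 x : 0 <= w x.
  rewrite /w x2; have [rx|/ltW rx] := leP r `|x|.
    by rewrite mulr_ge0 ?subr_ge0 ?sgn// ler_sqr ?nnegrE.
  by rewrite mulr_le0 ?subr_le0 ?sgn'// ler_sqr ?nnegrE.
have gw : 0 < gauss w.
  apply: (@gauss_gt0 _ _ r) => // x /eqP; rewrite /w mulf_eq0 !subr_eq0.
  have h : `|x| = r -> x = r \/ x = - r.
    move=> <-; have [x0|x0] := leP 0 x; [left|right].
      by rewrite ger0_norm.
    by rewrite ltr0_norm// opprK.
  case/orP => /eqP xr; apply: h.
    by apply/eqP; rewrite eq_le -sgn -sgn' xr lexx.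
  by apply/eqP; rewrite -(eqrXn2 (n := 2))// -x2 xr.
(* From [T^q >= 4 m] it follows that [|t|^q / 2 >= m + |t|^q / 4] for [|t| > T], which is the origin
   of the 1/4 in the final constant. *)
pose T := Num.max 1 ((4 * m) `^ q^-1).
have T1 : 1 <= T by rewrite le_max lexx.
have T0 : 0 <= T by rewrite (le_trans ler01).
have Tq : 4 * m <= T `^ q.
  have m40 : 0 <= 4 * m by rewrite mulr_ge0 ?(ltW m0).
  by rewrite -[leLHS](powR_invK q0 m40) powR_le_inv ?powR_ge0// le_max lexx orbT.
have Tq1 : 1 <= T `^ q by rewrite -(powRr0 T) ler_powR// ltW.
have Tq0 : 0 < T `^ q by rewrite (lt_le_trans ltr01).
(* The smallest Gaussian factor on [|t| <= T], times the coefficient of the quadratic gain, divided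
   by the factor that compares [gfun q t] with [t^2]. *)
pose a := expR (- (T ^+ 2 / 2)) * (gauss w / 8) / T `^ q.
have a0 : 0 < a by rewrite !mulr_gt0 ?expR_gt0 ?invr_gt0.
exists (Num.min (1 / 4) a).
  by rewrite lt_min a0 divr_gt0.
move=> t; have g0 := gfun_ge0 q t.
have [tT|Tt] := leP `|t| T; last first.
  have -> : gfun q t = `|t| `^ q.
    by rewrite /gfun leNgt (le_lt_trans T1 Tt).
  have h1 := gauss_abs_ge t q0.
  have h2 : T `^ q <= `|t| `^ q by rewrite powR_le_inv// ltW.
  have h3 : Num.min (1 / 4) a * `|t| `^ q <= 1 / 4 * `|t| `^ q.
    by rewrite ler_wpM2r ?powR_ge0// ge_min lexx.
  by lra.
have gT : gfun q t <= T `^ q * t ^+ 2.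
  rewrite /gfun; case: (leP `|t| 1) => t1.
    by rewrite ler_peMl ?sqr_ge0.
  rewrite (le_trans (_ : _ <= T `^ q))//; first by rewrite powR_le_inv.
  by rewrite ler_peMr ?(ltW Tq0)// x2 expr_ge1// ltW.
have pN x : `|- x| `^ q = `|x| `^ q by rewrite normrN.
rewrite (gauss_shift t tq (fun x => powR_ge0 _ _) pN).
have tch := tame_coshR t.
(* The identity [E cosh (t eps) = exp (t^2 / 2)], read off the shift formula for the constant
   function 1. *)
have ch1 : expR (- (t ^+ 2 / 2)) * gauss (fun x => coshR (t * x)) = 1.
  have := @gauss_shift R t (fun=> 1) (tame_cst 1) (fun=> ler01) (fun=> erefl).
  rewrite gauss_cst => h1; rewrite [RHS]h1; congr (_ * gauss _).
  by apply/funext => x; rewrite mul1r.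
(* [|x|^q - m] has mean zero and the sign of [cosh (t x) - cosh (t r)], so
   subtracting the constant [cosh (t r)] makes the integrand nonnegative. *)
have key : t ^+ 2 / 8 * gauss w <=
    gauss (fun x => `|x| `^ q * coshR (t * x)) - m * gauss (fun x => coshR (t * x)).
  rewrite -gaussZ//.
  have -> : gauss (fun x => `|x| `^ q * coshR (t * x)) - m * gauss (fun x => coshR (t * x)) =
      gauss (fun x => (`|x| `^ q - m) * (coshR (t * x) + - coshR (t * r))).
    rewrite (_ : (fun x => (`|x| `^ q - m) * (coshR (t * x) + - coshR (t * r))) =
       fun x => (`|x| `^ q * coshR (t * x) + (- m) * coshR (t * x)) +
         (- coshR (t * r)) * (`|x| `^ q - m)).
      have t1 : tame (fun x => `|x| `^ q * coshR (t * x)) by exact: tameM.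
      have t2 : tame (fun x => - m * coshR (t * x)) by apply: tameM => //; exact: tame_cst.
      have t3 : tame (fun x => - coshR (t * r) * (`|x| `^ q - m)).
        by apply: tameM => //; exact: tame_cst.
      rewrite gaussD//; last exact: tameD.
      rewrite gaussD// !gaussZ// gaussD//; last exact: tame_cst.
      by rewrite gauss_cst -/(mu q) -/m subrr mulr0 addr0 mulNr.
    by apply/funext => x; ring.
  apply: gauss_le.
  - by apply: tameM => //; exact: tame_cst.
  - by apply: tameM => //; apply: tameD => //; exact: tame_cst.
  move=> x; rewrite /w.
  rewrite (_ : _ * _ = (`|x| `^ q - m) * (((t * x) ^+ 2 - (t * r) ^+ 2) / 8)); last by field.
  have [rx|/ltW rx] := leP r `|x|.
    rewrite ler_wpM2l ?subr_ge0 ?sgn//; apply: coshR_sub_ge.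
    by rewrite !normrM ler_wpM2l// (ger0_norm r0).
  rewrite ler_wnM2l ?subr_le0 ?sgn'//.
  have := @coshR_sub_ge R (t * r) (t * x); rewrite !normrM ler_wpM2l ?(ger0_norm r0)// => /(_ isT).
  by lra.
have e1 : expR (- (T ^+ 2 / 2)) <= expR (- (t ^+ 2 / 2)).
  by rewrite ler_expR lerN2 ler_pM2r ?invr_gt0// x2 ler_sqr ?nnegrE.
have e0 := expR_gt0 (- (t ^+ 2 / 2)).
have h1 : Num.min (1 / 4) a * gfun q t <= a * (T `^ q * t ^+ 2).
  rewrite ler_pM ?ge_min ?lexx ?orbT//.
  by rewrite le_min (ltW a0) divr_ge0.
have h2 : a * (T `^ q * t ^+ 2) = expR (- (T ^+ 2 / 2)) * (t ^+ 2 / 8 * gauss w).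
  by rewrite /a; field; rewrite gt_eqF.
have h3 : expR (- (T ^+ 2 / 2)) * (t ^+ 2 / 8 * gauss w) <=
   expR (- (t ^+ 2 / 2)) * (t ^+ 2 / 8 * gauss w).
  by rewrite ler_wpM2r// mulr_ge0 ?(ltW gw)// divr_ge0 ?sqr_ge0.
have h4 := ler_wpM2l (ltW e0) key.
rewrite mulrBr [X in _ <= _ - X]mulrCA ch1 mulr1 in h4.
by lra.
Qed.

End LowerMoments.

(** * Variances, second moments and the cost of the tilt *)

Section Variance.
Context {R : realType}.
Implicit Types (f g : R -> R) (s t x y p q : R).

(** If [|x| <= r |t|], then [|t + x|] lies between [l |t|] and [u |t|], where [l^q = 1 - d] and
    [u^q = 1 + d]. Otherwise [|t| < |x| / r], and everything is a multiple of [|x|^q]. *)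
Lemma powR_diff_le q d : 0 < q -> 0 < d < 1 ->
  exists2 K, 0 < K & forall t x : R,
    `| `|t + 1 * x| `^ q - `|t| `^ q | <= d * `|t| `^ q + K * `|x| `^ q.
Proof.
move=> q0 /andP[d0 d1].
have root y : 0 <= y -> exists2 u, 0 <= u & u `^ q = y.
  by move=> y0; exists (y `^ q^-1); [exact: powR_ge0|exact: powR_invK].
have [u u0 uq] : exists2 u, 0 <= u & u `^ q = 1 + d by apply: root; lra.
have [l l0 lq] : exists2 l, 0 <= l & l `^ q = 1 - d by apply: root; lra.
have oneq : 1 `^ q = 1 :> R by rewrite powR1.
have u1 : 1 < u.
  by rewrite ltNge -(powR_le_inv q0 u0 ler01) uq oneq -ltNge; lra.
have l1 : l < 1.
  by rewrite ltNge -(powR_le_inv q0 ler01 l0) lq oneq -ltNge; lra.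
pose r := Num.min (u - 1) (1 - l).
have r0 : 0 < r by rewrite lt_min !subr_gt0 u1.
have ru : 1 + r <= u by rewrite -lerBrDl ge_min lexx.
have rl : l <= 1 - r by rewrite lerBrDr -lerBrDl ge_min lexx orbT.
have rV0 : 0 < r^-1 by rewrite invr_gt0.
have Kq0 : 0 < (r^-1 + 1) `^ q by rewrite powR_gt0// addr_gt0.
have Kq1 : 0 < r^-1 `^ q by rewrite powR_gt0.
exists ((r^-1 + 1) `^ q + r^-1 `^ q); first by rewrite addr_gt0.
move=> t x; rewrite mul1r.
have tq := powR_ge0 `|t| q; have xq := powR_ge0 `|x| q.
have txq := powR_ge0 `|t + x| q.
have [xt|tx] := leP `|x| (r * `|t|); last first.
  have tx1 : `|t| <= r^-1 * `|x| by rewrite mulrC ler_pdivlMr// mulrC ltW.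
  have h1 : `|t + x| `^ q <= (r^-1 + 1) `^ q * `|x| `^ q.
    rewrite -powRM ?addr_ge0 ?(ltW rV0)// powR_le_inv ?mulr_ge0 ?addr_ge0 ?(ltW rV0)//.
    by rewrite (le_trans (ler_normD _ _))// mulrDl mul1r lerD2r.
  have h2 : `|t| `^ q <= r^-1 `^ q * `|x| `^ q.
    by rewrite -powRM ?(ltW rV0)// powR_le_inv ?mulr_ge0 ?(ltW rV0).
  have h3 := mulr_ge0 (ltW d0) tq.
  by rewrite ler_norml mulrDl; apply/andP; split; lra.
have h1 : `|t + x| `^ q <= (1 + d) * `|t| `^ q.
  rewrite -uq -powRM// powR_le_inv ?mulr_ge0//.
  rewrite (le_trans (ler_normD _ _))// (le_trans (_ : _ <= (1 + r) * `|t|))//.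
    by rewrite mulrDl mul1r lerD2l.
  by rewrite ler_wpM2r.
have h2 : (1 - d) * `|t| `^ q <= `|t + x| `^ q.
  rewrite -lq -powRM// powR_le_inv ?mulr_ge0//.
  rewrite (le_trans (_ : _ <= (1 - r) * `|t|))//; first by rewrite ler_wpM2r.
  rewrite mulrBl mul1r lerBlDr -{1}(addrK x t) (le_trans (ler_normB _ _))//.
  by rewrite lerD2l.
have h3 : 0 <= ((r^-1 + 1) `^ q + r^-1 `^ q) * `|x| `^ q.
  by rewrite mulr_ge0// addr_ge0// ltW.
by rewrite ler_norml; apply/andP; split; lra.
Qed.

Lemma gauss_var_le f a : tame f ->
  gauss (fun x => f x ^+ 2) - gauss f ^+ 2 <= gauss (fun x => (f x - a) ^+ 2).
Proof.
move=> tf.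
have -> : (fun x => (f x - a) ^+ 2) = fun x => f x ^+ 2 + (- (2 * a) * f x + a ^+ 2).
  by apply/funext => x; ring.
have t1 : tame (fun x => - (2 * a) * f x) by apply: tameM => //; exact: tame_cst.
rewrite gaussD; [|exact: tameX|by apply: tameD => //; exact: tame_cst].
rewrite gaussD//; last exact: tame_cst.
rewrite gaussZ// gauss_cst.
have := sqr_ge0 (gauss f - a).
have -> : (gauss f - a) ^+ 2 = gauss f ^+ 2 + (- (2 * a) * gauss f + a ^+ 2) by ring.
by lra.
Qed.

(** The coefficient [e] has to be arbitrarily small: after summation its term competes with the
    square of the gain in mean, which is of the same order. Centring at [|t|^q] bounds the variance
    by the mean square of a difference of powers. *)
Lemma gauss_abs_var q e : 0 < q -> 0 < e ->
  exists2 K, 0 < K & forall t : R,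
    gauss (fun x => (`|t + 1 * x| `^ q) ^+ 2) - gauss (fun x => `|t + 1 * x| `^ q) ^+ 2
    <= e * (`|t| `^ q) ^+ 2 + K.
Proof.
(* Since [(d a + K b)^2 <= 2 d^2 a^2 + 2 K^2 b^2], the choice must satisfy [2 d^2 <= e] besides
   [d < 1]. *)
move=> q0 e0; pose d := Num.min (2^-1) (e / 2).
have d01 : 0 < d < 1.
  have dp : 0 < d by rewrite lt_min invr_gt0 ltr0n divr_gt0.
  have dl : d <= 2^-1 by rewrite ge_min lexx.
  by apply/andP; split => //; lra.
have de : 2 * d ^+ 2 <= e.
  have /andP[d0 _] := d01.
  have d1 : d <= 2^-1 by rewrite ge_min lexx.
  have d2 : d <= e / 2 by rewrite ge_min lexx orbT.
  have : d * d <= 2^-1 * (e / 2) by apply: ler_pM => //; exact: ltW.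
  by rewrite expr2; lra.
have [K K0 hK] := powR_diff_le q0 d01.
have ta := tameX 2 (tame_abs q0).
pose M := gauss (fun x : R => (`|x| `^ q) ^+ 2).
have M0 : 0 <= M by apply: gauss_ge0 => x; exact: sqr_ge0.
exists (2 * K ^+ 2 * M + 1).
  by rewrite ltr_wpDl// mulr_ge0// mulr_ge0// sqr_ge0.
move=> t; have tq := @tame_powR R t 1 _ q0.
apply: (le_trans (gauss_var_le (`|t| `^ q) tq)).
apply: (@le_trans _ _ (gauss (fun x => e * (`|t| `^ q) ^+ 2 + (2 * K ^+ 2) * (`|x| `^ q) ^+ 2))).
  apply: gauss_le.
  - by apply: tameX; apply: tameD => //; exact: tame_cst.
  - by apply: tameD; [exact: tame_cst|apply: tameM => //; exact: tame_cst].
  move=> x; have := hK t x.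
  have b0 := powR_ge0 `|x| q; have a0 := powR_ge0 `|t| q.
  move: (`|t| `^ q) (`|x| `^ q) a0 b0 => a b a0 b0 h.
  have /andP[d0 _] := d01.
  rewrite -real_normK ?num_real//.
  apply: (@le_trans _ _ ((d * a + K * b) ^+ 2)).
    by rewrite ler_sqr ?nnegrE// addr_ge0// mulr_ge0// ltW.
  have h2 := sqr_ge0 (d * a - K * b).
  have h3 : 2 * d ^+ 2 * a ^+ 2 <= e * a ^+ 2 by rewrite ler_wpM2r// sqr_ge0.
  have -> : (d * a + K * b) ^+ 2 =
    2 * d ^+ 2 * a ^+ 2 + 2 * K ^+ 2 * b ^+ 2 - (d * a - K * b) ^+ 2 by ring.
  by lra.
rewrite gaussD; [|exact: tame_cst|by apply: tameM => //; exact: tame_cst].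
rewrite gauss_cst gaussZ// -/M; lra.
Qed.

(** The constant is uniform in [s], which will depend on the dimension. *)
Lemma gauss_abs_sqr_le p : 0 < p ->
  exists2 K, 0 < K & forall s t : R, 0 < s <= 1 ->
    gauss (fun x => (`|t + s * x| `^ p) ^+ 2) <= K * ((`|t| `^ p) ^+ 2 + 1).
Proof.
move=> p0; pose M := gauss (fun x : R => (`|x| `^ p) ^+ 2).
have ta := tameX 2 (tame_abs p0).
have M0 : 0 <= M by apply: gauss_ge0 => x; exact: sqr_ge0.
pose c : R := 2 * (2 `^ p) ^+ 2.
have c0 : 0 < c by rewrite mulr_gt0// exprn_gt0// powR_gt0.
exists (c * (1 + M)); first by rewrite mulr_gt0// ltr_wpDr.
move=> s t hs.
apply: (@le_trans _ _ (gauss (fun x => c * ((`|t| `^ p) ^+ 2 + (`|x| `^ p) ^+ 2)))).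
  apply: gauss_le.
  - by apply: tameX; exact: tame_powR.
  - by apply: tameM; [exact: tame_cst|apply: tameD => //; exact: tame_cst].
  move=> x; have := gauss_abs_le t p0 hs x.
  have b0 := powR_ge0 `|x| p; have a0 := powR_ge0 `|t| p.
  have := powR_ge0 `|t + s * x| p.
  move: (`|t| `^ p) (`|x| `^ p) (`|t + s * x| `^ p) a0 b0 => a b h a0 b0 h0 le.
  apply: (@le_trans _ _ ((2 `^ p * (a + b)) ^+ 2)).
    by rewrite ler_sqr ?nnegrE// mulr_ge0 ?powR_ge0// addr_ge0.
  rewrite exprMn (_ : c * _ = (2 `^ p) ^+ 2 * (2 * (a ^+ 2 + b ^+ 2))).
    2: by rewrite /c; ring.
  rewrite ler_wpM2l ?sqr_ge0//.
  have h2 := sqr_ge0 (a - b).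
  have -> : (a + b) ^+ 2 = 2 * (a ^+ 2 + b ^+ 2) - (a - b) ^+ 2 by ring.
  by lra.
rewrite gaussZ; last by apply: tameD => //; exact: tame_cst.
rewrite gaussD//; last exact: tame_cst.
rewrite gauss_cst -/M -(mulrA c) ler_wpM2l ?(ltW c0)//.
have := mulr_ge0 M0 (sqr_ge0 (`|t| `^ p)).
by move: ((`|t| `^ p) ^+ 2) => a; lra.
Qed.

Lemma gauss_tilt s : 0 < s -> gauss (tilt 0 s) = 1.
Proof.
move=> s0; have := @gauss_affine R 0 s (fun=> 1) s0 (tame_cst 1) (fun=> ler01).
rewrite gauss_cst => h; rewrite [RHS]h; congr gauss.
by apply/funext => x; rewrite mul1r.
Qed.

(** The squared density ratio is [u / s^2] times the ratio for N(0, u^2), where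
    [1 / u^2 = 2 / s^2 - 1]. Hence the second moment equals [(1 - v^2)^(-1/2)]: there is no term
    linear in [v]. *)
Lemma gauss_tilt_sqr s v : 0 < s -> s ^+ 2 = 1 - v -> 0 <= v <= 2^-1 ->
  gauss (fun x => tilt 0 s x ^+ 2) <= expR (v ^+ 2).
Proof.
move=> s0 sv /andP[v0 v1].
pose u := s / Num.sqrt (1 + v).
have v10 : 0 < 1 + v by lra.
have w0 : 0 < Num.sqrt (1 + v) by rewrite sqrtr_gt0.
have u0 : 0 < u by rewrite divr_gt0.
have u2 : u ^+ 2 = (1 - v) / (1 + v) by rewrite expr_div_n sv sqr_sqrtr// ltW.
have s2 : 0 < s ^+ 2 by rewrite exprn_gt0.
have u1 : u <= 1.
  by rewrite -(@expr_le1 _ 2)// ?(ltW u0)// u2 ler_pdivrMr//; lra.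
have -> : gauss (fun x => tilt 0 s x ^+ 2) = u / s ^+ 2.
  rewrite -[RHS]mulr1 -(gauss_tilt u0) -gaussZ; last by apply: tame_tilt; rewrite u0.
  congr gauss; apply/funext => x; rewrite /tilt subr0 exprMn -expRM_natr.
  rewrite (_ : (x ^+ 2 / 2 - x ^+ 2 / (2 * s ^+ 2)) * 2 = x ^+ 2 / 2 - x ^+ 2 / (2 * u ^+ 2)).
    by field; rewrite !gt_eqF.
  by rewrite u2 sv; field; apply/andP; split; rewrite gt_eqF//; lra.
have v2 : v ^+ 2 <= 2^-1 by rewrite expr2; have := ler_pM v0 v0 v1 v1; lra.
have us0 : 0 <= u / s ^+ 2 by exact: divr_ge0 (ltW u0) (ltW s2).
rewrite -ler_sqr ?nnegrE ?expR_ge0//.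
rewrite expr_div_n u2 sv -expRM_natr.
apply: le_trans (expR_ge1Dx _).
rewrite (_ : _ / _ / _ = (1 - v ^+ 2)^-1); last first.
  by field; apply/and3P; split; rewrite gt_eqF//; nra.
rewrite -[leLHS]mul1r ler_pdivrMr; last by lra.
have := sqr_ge0 (v ^+ 2); have := sqr_ge0 v; move: (v ^+ 2) v2 => w; nra.
Qed.

End Variance.

(** * Deviations of power sums *)

Section Deviations.
Context {R : realType} {disp : measure_display} {T : measurableType disp}.
Context {P : probability T R} {eps : nat -> {RV P >-> R}}.
Hypothesis heps : iid_standard_normal eps.
Local Notation N := (normal_prob (0 : R) 1).
Implicit Types (p q s t : R) (theta : nat -> R) (n : nat).

(** The factor [1 *] keeps each summand in the form [t + s * x] of the Gaussian lemmas. *)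
Definition psum p theta n w := \sum_(i < n) `|theta i + 1 * eps i w| `^ p.

Lemma tame_measurable (f : R -> R) : tame f -> measurable_fun setT f.
Proof. by move=> [cf _]; exact: continuous_measurable_fun. Qed.

Lemma measurable_psum p theta n : 0 < p -> measurable_fun setT (psum p theta n).
Proof.
move=> p0; apply: measurable_sum => i.
apply: (measurableT_comp (tame_measurable (@tame_powR R (theta i) 1 p p0))).
exact: (measurable_funP (eps i)).
Qed.

Lemma measurable_psum_lt p theta n c : 0 < p -> measurable [set w | psum p theta n w < c].
Proof.
move=> p0; rewrite (_ : [set w | _] = psum p theta n @^-1` `]-oo, c[); last first.
  by apply/seteqP; split => w; rewrite /= in_itv.
by rewrite -[_ @^-1` _]setTI; exact: measurable_psum.
Qed.

Lemma measurable_psum_ge p theta n c : 0 < p -> measurable [set w | c <= psum p theta n w].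
Proof.
move=> p0; rewrite (_ : [set w | _] = psum p theta n @^-1` `[c, +oo[); last first.
  by apply/seteqP; split => w; rewrite /= in_itv/= andbT.
by rewrite -[_ @^-1` _]setTI; exact: measurable_psum.
Qed.

Lemma measurable_psum_dev p theta n m c : 0 < p ->
  measurable [set w | c <= `|psum p theta n w - m|].
Proof.
move=> p0; have mS : measurable_fun setT (fun w => `|psum p theta n w - m|).
  apply: measurableT_comp => //; apply: measurable_funB => //; exact: measurable_psum.
rewrite (_ : [set w | _] = (fun w => `|psum p theta n w - m|) @^-1` `[c, +oo[); last first.
  by apply/seteqP; split => w; rewrite /= in_itv/= andbT.
by rewrite -[_ @^-1` _]setTI; exact: mS.
Qed.

Lemma gauss_weighted_chebyshev (n : nat) (l h : nat -> R -> R) (V c : R) :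
  (forall i, tame (l i)) -> (forall i, tame (h i)) ->
  (forall i x, 0 <= l i x) -> (forall i x, 0 <= h i x) ->
  (forall i, gauss (l i) = 1) -> 0 < c ->
  \sum_(i < n) (gauss (fun x => l i x * h i x ^+ 2) - gauss (fun x => l i x * h i x) ^+ 2)
    <= V ->
  (\int[P]_w (\prod_(i < n) l i (eps i w) *
     \1_[set w | (c <= `|\sum_(i < n) h i (eps i w) -
        \sum_(i < n) gauss (fun x => (l i x * h i x)%R)|)%R] w)%:E <= (V / c ^+ 2)%:E)%E.
Proof.
move=> tl th l0 h0 l1 c0 hV.
apply: (weighted_chebyshev heps (fun i => tame_measurable (tl i))
  (fun i => tame_measurable (th i)) l0 h0 _ l1 c0 hV) => i e _.
by apply: tame_integrable; apply: tameM => //; exact: tameX.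
Qed.

Lemma psum_chebyshev p theta n V c : 0 < p -> 0 < c ->
  \sum_(i < n) (gauss (fun x => (`|theta i + 1 * x| `^ p) ^+ 2) -
    gauss (fun x => `|theta i + 1 * x| `^ p) ^+ 2) <= V ->
  (P [set w | (c <= `|psum p theta n w -
     \sum_(i < n) gauss (fun x => `|theta i + 1 * x| `^ p)|)%R] <= (V / c ^+ 2)%:E)%E.
Proof.
move=> p0 c0 hV.
pose h (i : nat) (x : R) := `|theta i + 1 * x| `^ p.
have th i : tame (h i) by exact: tame_powR.
have E (i : nat) : gauss (fun x => 1 * h i x) = gauss (h i).
  by congr gauss; apply/funext => x; rewrite mul1r.
have E2 (i : nat) : gauss (fun x => 1 * h i x ^+ 2) = gauss (fun x => h i x ^+ 2).
  by congr gauss; apply/funext => x; rewrite mul1r.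
have := @gauss_weighted_chebyshev n (fun _ _ => 1) h V c (fun=> tame_cst 1) th
  (fun _ _ => ler01) (fun _ _ => powR_ge0 _ _) (fun=> gauss_cst 1) c0.
have -> : \sum_(i < n) (gauss (fun x => 1 * h i x ^+ 2) - gauss (fun x => 1 * h i x) ^+ 2) =
    \sum_(i < n) (gauss (fun x => h i x ^+ 2) - gauss (h i) ^+ 2).
  by apply: eq_bigr => i _; rewrite E E2.
have -> : \sum_(i < n) gauss (fun x => 1 * h i x) = \sum_(i < n) gauss (h i).
  by apply: eq_bigr => i _; rewrite E.
move=> /(_ hV).
under eq_integral => w _ do rewrite big1// mul1r.
by rewrite integral_indic ?setIT//; exact: measurable_psum_dev.
Qed.

(** Weighting by the density ratio of N(0, s^2) replaces [eps] by [s * eps] in law. Chebyshev then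
    gives the event tilted mass at least 1/2, second moments dominating variances, and the return to
    [P] costs the product [expR (v ^+ 2) ^+ n]. *)
Lemma psum_tilt_lower p theta n s v V c : 0 < p -> 0 < c ->
  0 < s -> s ^+ 2 = 1 - v -> 0 <= v <= 2^-1 ->
  \sum_(i < n) gauss (fun x => (`|theta i + s * x| `^ p) ^+ 2) <= V ->
  V / c ^+ 2 <= 2^-1 ->
  ((4 * expR (v ^+ 2) ^+ n)^-1%:E <= P [set w | (psum p theta n w <
     \sum_(i < n) gauss (fun x => `|theta i + s * x| `^ p) + c)%R])%E.
Proof.
move=> p0 c0 s0 sv hv hV Vc.
have s1 : 0 < s <= 1.
  by rewrite s0 -(@expr_le1 _ 2)// ?(ltW s0)// sv; case/andP: hv; lra.
pose h (i : nat) (x : R) := `|theta i + 1 * x| `^ p.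
pose l (i : nat) := @tilt R 0 s.
have th i : tame (h i) by exact: tame_powR.
have tl i : tame (l i) by exact: tame_tilt.
have l0 i x : 0 <= l i x by rewrite tilt_ge0// ltW.
have h0 i x : 0 <= h i x by exact: powR_ge0.
have l1 i : gauss (l i) = 1 by exact: gauss_tilt.
have E i : gauss (fun x => l i x * h i x) = gauss (fun x => `|theta i + s * x| `^ p).
  rewrite (_ : (fun x => `|theta i + s * x| `^ p) = fun x => h i (0 + s * x)); last first.
    by apply/funext => x; rewrite /h add0r mul1r.
  by rewrite gauss_affine//; congr gauss; apply/funext => x; rewrite mulrC.
have E2 i : gauss (fun x => l i x * h i x ^+ 2) = gauss (fun x => (`|theta i + s * x| `^ p) ^+ 2).
  rewrite (_ : (fun x => (`|theta i + s * x| `^ p) ^+ 2) =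
      fun x => (h i (0 + s * x)) ^+ 2); last first.
    by apply/funext => x; rewrite /h add0r mul1r.
  rewrite (@gauss_affine _ 0 s (fun x => h i x ^+ 2))//.
  - by congr gauss; apply/funext => x; rewrite mulrC.
  - exact: tameX.
  - by move=> x; exact: sqr_ge0.
set m := \sum_(i < n) gauss _; set A := [set w | _].
have mA : measurable A by exact: measurable_psum_lt.
pose B := [set w | c <= `|psum p theta n w - m|].
have mB : measurable B by exact: measurable_psum_dev.
have hB := @gauss_weighted_chebyshev n l h V c tl th l0 h0 l1 c0.
have {}hB : (\int[P]_w (\prod_(i < n) l i (eps i w) * \1_B w)%:E <= 2^-1%:E)%E.
  apply: le_trans (_ : _ <= (V / c ^+ 2)%:E)%E _; last by rewrite lee_fin.
  have hV' : \sum_(i < n) (gauss (fun x => l i x * h i x ^+ 2) -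
      gauss (fun x => l i x * h i x) ^+ 2) <= V.
    apply: le_trans hV; apply: ler_sum => i _.
    by rewrite E2 gerBl sqr_ge0.
  have := hB hV'; rewrite (eq_bigr (fun i : 'I_n => gauss (fun x => `|theta i + s * x| `^ p))).
    by [].
  by move=> i _; exact: E.
apply: (@prob_tilt_le _ _ _ _ _ heps n l (fun i => tame_measurable (tl i)) l0) => //.
- by rewrite exprn_gt0// expR_gt0.
- apply: le_trans (_ : _ <= \prod_(i < n) expR (v ^+ 2)) _.
    apply: ler_prod => i _; apply/andP; split; first by apply: Rintegral_ge0 => x _; exact: sqr_ge0.
    exact: gauss_tilt_sqr.
  by rewrite prodr_const card_ord.
- by move=> i; apply: tame_integrable; exact: tameX.
have mL : measurable_fun setT (fun w => \prod_(i < n) l i (eps i w)).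
  apply: (@measurable_prod_noise _ _ _ _ _ n l xpredT) => i; exact: tame_measurable.
have L0 w : 0 <= \prod_(i < n) l i (eps i w) by apply: prodr_ge0.
have i1 : (\int[P]_w (\prod_(i < n) l i (eps i w))%:E = 1)%E.
  rewrite (integral_prod_noise heps n (fun i => tame_measurable (tl i)) l0
    (fun i => tame_integrable (tl i))).
  by rewrite big1// => i _; exact: l1.
have mLi D : measurable D ->
    measurable_fun setT (fun w => (\prod_(i < n) l i (eps i w) * \1_D w)%:E).
  by move=> mD; apply/measurable_EFinP/measurable_funM => //; exact: measurable_indic.
have Li0 D w : setT w -> (0 <= (\prod_(i < n) l i (eps i w) * \1_D w)%:E)%E.
  by move=> _; rewrite lee_fin mulr_ge0.
have : (1 <= \int[P]_w (\prod_(i < n) l i (eps i w) * \1_A w)%:E +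
  \int[P]_w (\prod_(i < n) l i (eps i w) * \1_B w)%:E)%E.
  rewrite -(ge0_integralD _ measurableT (Li0 A) (mLi A mA) (Li0 B) (mLi B mB)) -i1.
  apply: ge0_le_integral => //.
  - by move=> w _; rewrite lee_fin.
  - exact/measurable_EFinP.
  - by apply: emeasurable_funD; exact: mLi.
  move=> w _; rewrite -EFinD lee_fin -mulrDr ler_peMr//.
  rewrite !indicE; have [wA|wA] := boolP (w \in A); first by rewrite lerDl.
  rewrite mem_set ?addr0 ?add0r//=.
  move/negP: wA; rewrite inE /A/= => /negP; rewrite -leNgt => h1.
  by rewrite /B/= (le_trans _ (ler_norm _))// lerBrDl.
move: hB; case: (integral _ _ (fun w => (_ * \1_B w)%:E)) => [b| |]//; last first.
  by move=> _; rewrite addeNy leeNy_eq.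
case: (integral _ _ _) => [a| |]//; rewrite ?leey// -EFinD !lee_fin; lra.
Qed.

End Deviations.

(** * Power sums under large and under bounded signals *)

Section Consistency.
Context {R : realType} {disp : measure_display} {T : measurableType disp}.
Context {P : probability T R} {eps : nat -> {RV P >-> R}}.
Hypothesis heps : iid_standard_normal eps.
Implicit Types (p q s t : R) (theta : nat -> R) (n : nat).
Local Notation psum p theta n := (@psum R disp T P eps p theta n).

Definition gsum p theta n := \sum_(i < n) gfun p (theta i).

Lemma gsum_ge0 p theta n : 0 <= gsum p theta n.
Proof. by apply: sumr_ge0 => i _; exact: gfun_ge0. Qed.

(** Coordinates in [[-1, 1]] contribute at most 1 each; any other contributes the square of its
    [gfun], itself at most [gfun] times the whole sum. *)
Lemma sum_powR_sqr_le p theta n : 0 < p ->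
  \sum_(i < n) (`|theta i| `^ p) ^+ 2 <= n%:R + gsum p theta n ^+ 2.
Proof.
move=> p0; apply: (@le_trans _ _ (\sum_(i < n) (1 + gfun p (theta i) * gsum p theta n))).
  apply: ler_sum => i _.
  have g0 := gfun_ge0 p (theta i).
  have gle : gfun p (theta i) <= gsum p theta n.
    by rewrite /gsum (bigD1 i)//= lerDl sumr_ge0// => j _; exact: gfun_ge0.
  have gg : gfun p (theta i) ^+ 2 <= gfun p (theta i) * gsum p theta n.
    by rewrite expr2 ler_wpM2l.
  apply: le_trans (_ : _ <= 1 + gfun p (theta i) ^+ 2) _; last by rewrite lerD2l.
  have y0 := powR_ge0 `|theta i| p.
  rewrite {gle gg g0} /gfun; case: (leP `|theta i| 1) => t1; last by rewrite lerDr.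
  rewrite ler_wpDr ?sqr_ge0// expr_le1//.
  have <- : 1 `^ p = 1 :> R by rewrite powR1.
  by rewrite powR_le_inv.
by rewrite big_split/= -mulr_suml sumr_const card_ord -expr2.
Qed.

Lemma psum_small_prob q t d : 0 < q -> 0 <= t -> 0 < d ->
  exists2 M, 0 < M & forall n theta, (0 < n)%N ->
    M * Num.sqrt n%:R <= gsum q theta n ->
    (P [set w | (psum q theta n w < n%:R * mu q + t * Num.sqrt n%:R)%R] <= d%:E)%E.
Proof.
move=> q0 t0 d0.
have [c c0 hc] := gauss_abs_lower q0.
(* Chebyshev at distance [c G / 2] allows a variance up to [d (c G / 2)^2 = 2 e G^2]; one half goes
   to the signal term, the other to the term linear in [n]. *)
pose e := d * c ^+ 2 / 8.
have e0 : 0 < e by rewrite divr_gt0// mulr_gt0// exprn_gt0.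
have [K K0 hK] := gauss_abs_var q0 e0.
have c20 : 0 < c ^+ 2 by rewrite exprn_gt0.
(* The first summand makes [t sqrt n] at most [c G / 2], the second makes [(e + K) n] at most
   [e G^2], and the last gives [M <= M^2]. *)
pose M := 2 * t / c + 8 * (e + K) / (c ^+ 2 * d) + 1.
have a1 : 0 <= 2 * t / c by rewrite divr_ge0 ?mulr_ge0// ltW.
have a2 : 0 <= 8 * (e + K) / (c ^+ 2 * d).
  by apply: ltW; apply: divr_gt0; apply: mulr_gt0 => //; exact: addr_gt0.
have M0 : 0 < M by rewrite /M; lra.
exists M => // n theta n0 hM; set G := gsum q theta n in hM *.
have rn0 : 0 < Num.sqrt n%:R :> R by rewrite sqrtr_gt0 ltr0n.
have rn2 : Num.sqrt n%:R ^+ 2 = n%:R :> R by rewrite sqr_sqrtr.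
have G0 : 0 < G by rewrite (lt_le_trans _ hM)// mulr_gt0.
pose m := \sum_(i < n) gauss (fun x => `|theta i + 1 * x| `^ q).
have hm : n%:R * mu q + c * G <= m.
  rewrite mulr_natl -[X in _ *+ X]card_ord -sumr_const mulr_sumr -big_split/=.
  by apply: ler_sum => i _; exact: hc.
have ht : t * Num.sqrt n%:R <= c * G / 2.
  have : c * (M * Num.sqrt n%:R) <= c * G by rewrite ler_wpM2l// ltW.
  have : c * (2 * t / c * Num.sqrt n%:R) <= c * (M * Num.sqrt n%:R).
    by rewrite ler_wpM2l ?(ltW c0)// ler_wpM2r ?(ltW rn0)// /M; lra.
  rewrite (_ : c * (2 * t / c * _) = 2 * (t * Num.sqrt n%:R)); first lra.
  by field; rewrite gt_eqF.
have cG0 : 0 < c * G / 2 by rewrite divr_gt0// mulr_gt0.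
pose V := e * G ^+ 2 + (e + K) * n%:R.
have hV : \sum_(i < n) (gauss (fun x => (`|theta i + 1 * x| `^ q) ^+ 2) -
    gauss (fun x => `|theta i + 1 * x| `^ q) ^+ 2) <= V.
  apply: (@le_trans _ _ (\sum_(i < n) (e * (`|theta i| `^ q) ^+ 2 + K))).
    by apply: ler_sum => i _; exact: hK.
  rewrite big_split/= -mulr_sumr sumr_const card_ord -mulr_natr.
  have := ler_wpM2l (ltW e0) (sum_powR_sqr_le theta n q0).
  by rewrite -/G /V; lra.
have := psum_chebyshev heps q0 cG0 hV; rewrite -/m => hP.
apply: le_trans (_ : _ <= (V / (c * G / 2) ^+ 2)%:E)%E _.
  apply: le_trans hP; apply: le_measure; rewrite ?inE.
  - exact: measurable_psum_lt.
  - exact: measurable_psum_dev.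
  by move=> w /= hw; rewrite distrC (le_trans _ (ler_norm _))//; lra.
rewrite lee_fin ler_pdivrMr ?exprn_gt0//.
have hG : M * n%:R <= G ^+ 2.
  have : (M * Num.sqrt n%:R) ^+ 2 <= G ^+ 2.
    by rewrite ler_sqr ?nnegrE ?(ltW G0)// mulr_ge0 ?ltW.
  rewrite exprMn rn2; apply: le_trans; rewrite ler_wpM2r// expr2 ler_peMl ?(ltW M0)//.
  by rewrite /M; lra.
have hG2 : (e + K) * n%:R <= e * G ^+ 2.
  have h1 : 8 * (e + K) / (c ^+ 2 * d) * n%:R <= G ^+ 2.
    by apply: le_trans hG; rewrite ler_wpM2r// /M; lra.
  have := ler_wpM2l (ltW e0) h1; rewrite {1}/e; apply: le_trans.
  by rewrite le_eqVlt; apply/orP; left; apply/eqP; field; rewrite !gt_eqF.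
rewrite (_ : d * (c * G / 2) ^+ 2 = 2 * (e * G ^+ 2)); last by rewrite /e; field.
by rewrite /V; lra.
Qed.

(** Factoring [s] out of [|t + s x|] replaces the shift [t] by [t / s]; this bounds the effect on
    the signal. *)
Lemma gfun_scale p s t : 0 < p -> 2^-1 <= s <= 1 ->
  gfun p (t / s) <= 4 * (1 + 2 `^ p) * gfun p t.
Proof.
move=> p0 /andP[s12 s1].
have s0 : 0 < s by lra.
have y2 : `|t / s| <= 2 * `|t|.
  rewrite normrM (ger0_norm (x := s^-1)) ?invr_ge0 ?(ltW s0)// mulrC ler_wpM2r//.
  by rewrite -[leRHS]invrK lef_pV2 ?posrE ?invr_gt0.
have ty : `|t| = s * `|t / s|.
  by rewrite -[in LHS](divfK (lt0r_neq0 s0) t) normrM mulrC (ger0_norm (ltW s0)).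
have p20 : 0 < 2 `^ p :> R by exact: powR_gt0.
have t0 := normr_ge0 t; have ys0 := normr_ge0 (t / s).
rewrite /gfun; case: (leP `|t / s| 1) => y1.
  rewrite ifT; last by rewrite ty; apply: mulr_ile1 => //; exact: ltW.
  rewrite -(real_normK (num_real (t / s))) -(real_normK (num_real t)).
  apply: (@le_trans _ _ ((2 * `|t|) ^+ 2)); first by rewrite ler_sqr ?nnegrE ?mulr_ge0.
  have := mulr_ge0 (ltW p20) (sqr_ge0 `|t|).
  by rewrite exprMn; lra.
have h : `|t / s| `^ p <= 2 `^ p * `|t| `^ p.
  by rewrite -powRM// powR_le_inv ?mulr_ge0.
apply: (le_trans h).
case: (leP `|t| 1) => t1; last first.
  have := powR_ge0 `|t| p => tp; have := mulr_ge0 (ltW p20) tp; lra.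
have tp1 : `|t| `^ p <= 1.
  have <- : 1 `^ p = 1 :> R by rewrite powR1.
  by rewrite powR_le_inv.
(* In the mixed case [|t| <= 1 < |t / s|], the value [|t|] stays above [s >= 1/2], so [t^2] is
   comparable with 1. *)
have ht : 2^-1 <= `|t|.
  rewrite ty; apply: (le_trans s12); rewrite ler_peMr ?ltW//.
have ht2 : 4^-1 <= t ^+ 2.
  rewrite -(real_normK (num_real t)); apply: (@le_trans _ _ (2^-1 ^+ 2)); first by lra.
  by rewrite ler_sqr ?nnegrE ?invr_ge0.
have h1 : 2 `^ p * `|t| `^ p <= 2 `^ p by rewrite ler_piMr// ltW.
have h2 : 2 `^ p * 4^-1 <= 2 `^ p * t ^+ 2 by rewrite ler_wpM2l// ltW.
by have := sqr_ge0 t; lra.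
Qed.

(** With [y = p v / 2] in [[0, 1]], the chain is [s^p <= exp (- y) <= 1 / (1 + y) <= 1 - y / 2]. It
    quantifies the first-order drop of the noise moments. *)
Lemma powR_scale_le p s v : 0 < p -> 0 < s -> s ^+ 2 = 1 - v -> 0 <= v -> p * v <= 2 ->
  s `^ p <= 1 - p * v / 4.
Proof.
move=> p0 s0 sv v0 pv.
have s_exp : s <= expR (- (v / 2)).
  rewrite -ler_sqr ?nnegrE ?expR_ge0 ?(ltW s0)// sv -expRM_natr.
  by have := expR_ge1Dx (- (v / 2) * 2); lra.
pose y := p * v / 2.
have y0 : 0 <= y by rewrite divr_ge0// mulr_ge0// ltW.
have y1 : y <= 1 by rewrite /y; lra.
have h : s `^ p <= expR (- y).
  rewrite (_ : - y = - (v / 2) * p); last by rewrite /y; field.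
  by rewrite expRM powR_le_inv ?expR_ge0// ltW.
apply: (le_trans h).
have e1 := expR_ge1Dx y.
rewrite expRN; apply: (@le_trans _ _ (1 + y)^-1).
  by rewrite lef_pV2 ?posrE ?expR_gt0//; lra.
rewrite -[leLHS]mul1r ler_pdivrMr; last by lra.
rewrite (_ : 1 - p * v / 4 = 1 - y / 2); last by rewrite /y; field.
nra.
Qed.

(** The bounds [d] and [n0] depend on [p], [t] and [M] alone, so the estimate applies to a different
    [theta] in each dimension. *)
Lemma psum_large_prob p t M : 0 < p -> 0 <= t -> 0 <= M ->
  exists2 d, 0 < d & exists n0, forall n theta, (n0 < n)%N ->
    gsum p theta n <= M * Num.sqrt n%:R ->
    (d%:E <= P [set w | (psum p theta n w < n%:R * mu p - t * Num.sqrt n%:R)%R])%E.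
Proof.
move=> p0 t0 M0.
have m0 := @mu_gt0 R _ p0.
have [C C0 hC] := gauss_abs_upper p0.
have [K K0 hK] := gauss_abs_sqr_le p0.
pose Kg : R := 4 * (1 + 2 `^ p).
have Kg0 : 0 <= Kg by rewrite mulr_ge0// addr_ge0// powR_ge0.
have M20 := sqr_ge0 M.
have KM0 : 0 < K * (2 + M ^+ 2) by rewrite mulr_gt0// ltr_wpDr.
(* With slack [b sqrt n], the inequality [b^2 >= b >= 2 K (2 + M^2)] brings the Chebyshev bound
   below 1/2. *)
pose b := 2 * (K * (2 + M ^+ 2)) + 1.
have b0 : 0 < b by rewrite /b; lra.
(* For [v = a / sqrt n] the mean drops by at least [n mu_p p v / 4 = (C Kg M + b + t) sqrt n], which
   covers the signal, the Chebyshev slack and the required [t sqrt n]. *)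
pose a := 4 * (C * Kg * M + b + t) / (mu p * p).
have mp0 : 0 < mu p * p by rewrite mulr_gt0.
have CKM0 : 0 <= C * Kg * M by rewrite !mulr_ge0// ltW.
have a0 : 0 < a by rewrite divr_gt0// mulr_gt0//; lra.
(* Once [sqrt n >= X], both [v <= 1/2] and [p v <= 2] hold. *)
pose X := 2 * a + a * p / 2.
have ap0 : 0 < a * p by rewrite mulr_gt0.
have X0 : 0 <= X by rewrite /X; lra.
exists ((4 * expR (a ^+ 2))^-1); first by rewrite invr_gt0 mulr_gt0// expR_gt0.
exists (Num.bound (X ^+ 2)) => n theta hn hG.
have n0 : (0 < n)%N by exact: leq_ltn_trans hn.
set r : R := Num.sqrt n%:R in hG *.
have r0 : 0 < r by rewrite sqrtr_gt0 ltr0n.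
have r2 : r ^+ 2 = n%:R by rewrite sqr_sqrtr.
have Xr : X <= r.
  rewrite -ler_sqr ?nnegrE ?(ltW r0)// r2.
  have := archi_boundP (sqr_ge0 X); move=> /ltW/le_trans; apply.
  by rewrite ler_nat ltnW.
pose v := a / r; pose s := Num.sqrt (1 - v).
have ar : a = v * r by rewrite /v divfK ?gt_eqF.
have v0 : 0 <= v by rewrite divr_ge0 ?ltW.
have v12 : v <= 2^-1 by rewrite /v ler_pdivrMr//; move: Xr; rewrite /X; lra.
have pv : p * v <= 2.
  by rewrite /v mulrA ler_pdivrMr//; move: Xr; rewrite /X; lra.
have v1 : 0 < 1 - v by lra.
have s0 : 0 < s by rewrite sqrtr_gt0.
have s2 : s ^+ 2 = 1 - v by rewrite sqr_sqrtr// ltW.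
have s1 : s <= 1 by rewrite -(@expr_le1 _ 2)// ?(ltW s0)// s2; lra.
have s12 : 2^-1 <= s.
  by rewrite -ler_sqr ?nnegrE ?invr_ge0 ?(ltW s0)// s2; lra.
have sp := powR_scale_le p0 s0 s2 v0 pv.
have sp0 := powR_ge0 s p.
pose V := K * (2 + M ^+ 2) * n%:R.
have hV : \sum_(i < n) gauss (fun x => (`|theta i + s * x| `^ p) ^+ 2) <= V.
  apply: (@le_trans _ _ (\sum_(i < n) (K * (`|theta i| `^ p) ^+ 2 + K))).
    by apply: ler_sum => i _; rewrite -[X in _ + X]mulr1 -mulrDr hK// s0.
  rewrite big_split/= -mulr_sumr sumr_const card_ord -mulr_natr.
  have h1 := ler_wpM2l (ltW K0) (sum_powR_sqr_le theta n p0).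
  have h2 : gsum p theta n ^+ 2 <= M ^+ 2 * n%:R.
    by rewrite -r2 -exprMn ler_sqr ?nnegrE ?gsum_ge0// mulr_ge0// ltW.
  have h3 := ler_wpM2l (ltW K0) h2.
  by rewrite /V; lra.
pose c := b * r; have c0 : 0 < c by rewrite mulr_gt0.
have Vc : V / c ^+ 2 <= 2^-1.
  rewrite ler_pdivrMr ?exprn_gt0// /c exprMn r2 mulrA ler_wpM2r//.
  have : b <= b ^+ 2 by rewrite expr2 ler_peMr ?(ltW b0)// /b; lra.
  by rewrite {1}/b; lra.
have hv : 0 <= v <= 2^-1 by rewrite v0.
have := psum_tilt_lower heps p0 c0 s0 s2 hv hV Vc.
have -> : expR (v ^+ 2) ^+ n = expR (a ^+ 2).
  have -> : a ^+ 2 = v ^+ 2 * n%:R by rewrite -r2 -exprMn -ar.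
  by rewrite expRM_natr.
move=> /le_trans; apply; apply: le_measure; rewrite ?inE.
- exact: measurable_psum_lt.
- exact: measurable_psum_lt.
move=> w /= hw; apply: (lt_le_trans hw).
have hm : \sum_(i < n) gauss (fun x => `|theta i + s * x| `^ p) <=
    \sum_(i < n) (s `^ p * mu p + C * Kg * gfun p (theta i)).
  apply: ler_sum => i _.
  have -> : gauss (fun x => `|theta i + s * x| `^ p) =
      s `^ p * gauss (fun x => `|theta i / s + 1 * x| `^ p).
    rewrite -gaussZ; last exact: tame_powR.
    congr gauss; apply/funext => x; rewrite -powRM ?(ltW s0)//; congr (_ `^ _).
    have -> : theta i + s * x = s * (theta i / s + 1 * x) by field; rewrite gt_eqF.
    by rewrite normrM (ger0_norm (ltW s0)).
  apply: (@le_trans _ _ (s `^ p * (mu p + C * gfun p (theta i / s)))).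
    by rewrite ler_wpM2l.
  rewrite mulrDr lerD2l.
  have g0 := gfun_ge0 p (theta i / s).
  apply: (@le_trans _ _ (C * gfun p (theta i / s))).
    rewrite ler_piMl ?mulr_ge0 ?(ltW C0)//.
    by apply: (le_trans sp); rewrite lerBlDr lerDl divr_ge0// mulr_ge0// ltW.
  by rewrite -mulrA ler_wpM2l ?(ltW C0)// gfun_scale// s12.
rewrite big_split/= -!mulr_sumr sumr_const card_ord -/(gsum p theta n) -(mulr_natr (mu p)) in hm.
have h1 : C * Kg * gsum p theta n <= C * Kg * M * r.
  by rewrite -[leRHS]mulrA ler_wpM2l// mulr_ge0// ltW.
have h2 : s `^ p * mu p * n%:R <= (1 - p * v / 4) * mu p * n%:R.
  by rewrite ler_wpM2r// ler_wpM2r// ltW.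
have h3 : (1 - p * v / 4) * mu p * n%:R = n%:R * mu p - (C * Kg * M + b + t) * r.
  rewrite -r2 /v /a; field; rewrite !gt_eqF//.
by rewrite /c; lra.
Qed.

End Consistency.

(** * Consistency sets *)

Section Asymptotics.
Context {R : realType} {disp : measure_display} {T : measurableType disp}.
Context {P : probability T R} {eps : nat -> {RV P >-> R}}.
Hypothesis heps : iid_standard_normal eps.
Implicit Types (p q s t : R) (theta : nat -> R) (n : nat).
Local Notation nsum := (@psum R disp T P eps).
Local Notation sqrtn n := (Num.sqrt n%:R : R).

Definition reject_prob p c theta n := fine (P [set w | c <= nsum p theta n w]).

Lemma reject_probE p c theta n : 0 < p ->
  P [set w | c <= nsum p theta n w] = (reject_prob p c theta n)%:E.
Proof. by move=> p0; rewrite fineK// fin_num_measure//; exact: measurable_psum_ge. Qed.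

Lemma psum_lt_prob p c theta n : 0 < p ->
  P [set w | nsum p theta n w < c] = (1 - reject_prob p c theta n)%:E.
Proof.
move=> p0; rewrite EFinB -reject_probE//.
rewrite -probability_setC; last exact: measurable_psum_ge.
congr (P _); apply/seteqP; split => w /=; first by rewrite ltNge => /negP.
by move=> /negP; rewrite ltNge.
Qed.

(** Rows become sequences indexed like the noise. Beyond [n], [inord] falls back on coordinate 0,
    but the sums over [n.+1] terms stop before that. *)
Definition row_coeffs n (x : 'rV[R]_n.+1) (i : nat) : R := x 0 (inord i).

(** Truncating the critical value at 0 leaves the test unchanged, the norm being nonnegative, and
    allows both sides to be raised to the power [p]. *)
Lemma expectation_pnorm_test p (kappa : nat -> R) n (x : 'rV[R]_n.+1) : 0 < p ->
  'E_P[fun w => pnorm_tests p kappa n (x + noise_vec eps n.+1 w)%R]%E =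
  (reject_prob p (Num.max (kappa n) 0 `^ p) (row_coeffs x) n.+1)%:E.
Proof.
move=> p0; rewrite -reject_probE//.
rewrite -expectation_indic; last exact: measurable_psum_ge.
congr expectation; apply/funext => w /=.
rewrite !indicE; congr (_%:R); congr nat_of_bool.
have S0 : 0 <= nsum p (row_coeffs x) n.+1 w by apply: sumr_ge0 => i _; exact: powR_ge0.
have E : pnorm p (x + noise_vec eps n.+1 w) = nsum p (row_coeffs x) n.+1 w `^ p^-1.
  rewrite /pnorm /psum; congr (_ `^ _); apply: eq_bigr => i _.
  by rewrite mxE [noise_vec _ _ _ _ _]mxE /row_coeffs inord_val mul1r.
have H : (kappa n <= pnorm p (x + noise_vec eps n.+1 w)) =
    (Num.max (kappa n) 0 `^ p <= nsum p (row_coeffs x) n.+1 w).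
  rewrite E; move: (nsum _ _ _ _) S0 (kappa n) => S S0 k.
  have k0 : 0 <= Num.max k 0 by rewrite le_max lexx orbT.
  by rewrite (powR_le_root p0 k0 S0) ge_max powR_ge0 andbT.
apply/idP/idP; rewrite !inE /rejection_region/= ?H//.
Qed.

Lemma cvg_reject_prob p (c : nat -> R) (theta : nat -> nat -> R) (a : R) :
  ((reject_prob p (c n) (theta n) n.+1)%:E @[n --> \oo] --> a%:E)%E ->
  forall e, 0 < e -> exists n0, forall n, (n0 <= n)%N ->
    `|reject_prob p (c n) (theta n) n.+1 - a| < e.
Proof.
move=> /fine_cvg /= h e e0.
have /cvgrPdist_lt/(_ e e0) [n0 _ hn] := h.
by exists n0 => n n0n; rewrite distrC; exact: hn.
Qed.

(** A threshold outside the window would put the null rejection event, or the acceptance event,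
    inside a deviation event of probability at most [e / 2]. For large [n] both probabilities exceed
    [e], since the limit [a] is at distance at least [2 e] from 0 and 1. *)
Lemma threshold_bounds p (c : nat -> R) (a : R) : 0 < p -> 0 < a < 1 ->
  ((reject_prob p (c n) (fun=> 0) n.+1)%:E @[n --> \oo] --> a%:E)%E ->
  exists2 t, 0 <= t & exists n0, forall n, (n0 <= n)%N ->
    n.+1%:R * mu p - t * sqrtn n.+1 <= c n <= n.+1%:R * mu p + t * sqrtn n.+1.
Proof.
move=> p0 /andP[a0 a1] hc.
pose e := Num.min a (1 - a) / 2.
have e0 : 0 < e by rewrite divr_gt0// lt_min a0 subr_gt0.
have ea : 2 * e <= a by rewrite /e mulrC divfK// ge_min lexx.
have ea' : 2 * e <= 1 - a by rewrite /e mulrC divfK// ge_min lexx orbT.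
have [n0 hn0] := cvg_reject_prob hc e0.
pose V := gauss (fun x : R => (`|0 + 1 * x| `^ p) ^+ 2).
have V0 : 0 <= V by apply: gauss_ge0 => x; exact: sqr_ge0.
(* Chosen so that [V <= (e / 2) t <= (e / 2) t^2], the second inequality by [t >= 1]. *)
pose t := 2 * V / e + 1.
have Ve0 : 0 <= 2 * V / e by apply: divr_ge0 (ltW e0); exact: mulr_ge0.
have e2 : 0 <= e / 2 by apply: divr_ge0 => //; exact: ltW.
exists t; first by rewrite /t; lra.
exists n0 => n /hn0 hn.
set r := sqrtn n.+1.
have r0 : 0 < r by rewrite sqrtr_gt0 ltr0n.
have r2 : r ^+ 2 = n.+1%:R by rewrite sqr_sqrtr.
have t0 : 0 < t by rewrite /t; lra.
have tr0 : 0 < t * r by rewrite mulr_gt0.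
have hV : \sum_(i < n.+1) (gauss (fun x : R => (`|0 + 1 * x| `^ p) ^+ 2) -
    gauss (fun x : R => `|0 + 1 * x| `^ p) ^+ 2) <= n.+1%:R * V.
  rewrite mulr_natl -[X in _ *+ X]card_ord -sumr_const; apply: ler_sum => i _.
  by rewrite gerBl sqr_ge0.
have := psum_chebyshev heps (theta := fun=> 0) p0 tr0 hV.
have -> : \sum_(i < n.+1) gauss (fun x : R => `|0 + 1 * x| `^ p) = n.+1%:R * mu p.
  have -> : (fun x : R => `|0 + 1 * x| `^ p) = fun x => `|x| `^ p.
    by apply/funext => x; rewrite add0r mul1r.
  by rewrite sumr_const card_ord mulr_natl.
set D := [set w | _] => hD.
have mD : measurable D by exact: measurable_psum_dev.
have {}hD : (P D <= (e / 2)%:E)%E.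
  apply: le_trans hD _; rewrite lee_fin exprMn r2 ler_pdivrMr; last first.
    by rewrite mulr_gt0 ?exprn_gt0.
  rewrite mulrC mulrA ler_wpM2r//.
  have : V <= e / 2 * t.
    rewrite /t mulrDr (_ : e / 2 * (2 * V / e) = V); first by rewrite lerDl mulr1.
    by field; rewrite gt_eqF.
  move/le_trans; apply; rewrite ler_wpM2l// expr2 ler_peMr ?(ltW t0)//.
  by rewrite /t; lra.
have hn' := hn; rewrite ltr_norml in hn'; case/andP: hn' => h1 h2.
apply/andP; split; rewrite leNgt; apply/negP => hcn.
- have : (P [set w | (nsum p (fun=> 0%R) n.+1 w < c n)%R] <= P D)%E.
    apply: le_measure; rewrite ?inE//; first exact: measurable_psum_lt.
    by move=> w /= hw; rewrite /D/= distrC (le_trans _ (ler_norm _))//; lra.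
  by rewrite psum_lt_prob// => /le_trans/(_ hD); rewrite lee_fin; lra.
- have : (P [set w | (c n <= nsum p (fun=> 0%R) n.+1 w)%R] <= P D)%E.
    apply: le_measure; rewrite ?inE//; first exact: measurable_psum_ge.
    by move=> w /= hw; rewrite /D/= (le_trans _ (ler_norm _))//; lra.
  by rewrite reject_probE// => /le_trans/(_ hD); rewrite lee_fin; lra.
Qed.

Definition gsum_diverges p (theta : nat -> nat -> R) := forall M : R, exists n0, forall n,
  (n0 <= n)%N -> M * sqrtn n.+1 < gsum p (theta n) n.+1.

Section Threshold.
Variables (p : R) (c : nat -> R) (a : R).
Hypotheses (p0 : 0 < p) (a01 : 0 < a < 1).
Hypothesis hc : ((reject_prob p (c n) (fun=> 0) n.+1)%:E @[n --> \oo] --> a%:E)%E.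

(** A single late dimension with [gsum] at most [M sqrt n] is contradictory: it leaves acceptance
    probability at least [d], with [d] fixed beforehand, where the rejection probability already
    exceeds [1 - d]. *)
Lemma consistent_gsum_diverges (theta : nat -> nat -> R) :
  ((reject_prob p (c n) (theta n) n.+1)%:E @[n --> \oo] --> 1%:E)%E -> gsum_diverges p theta.
Proof.
move=> h1 M; have [t t0 [n1 hn1]] := threshold_bounds p0 a01 hc.
have M0 : 0 <= Num.max M 0 by rewrite le_max lexx orbT.
have [d d0 [n2 hn2]] := psum_large_prob heps p0 t0 M0.
have [n3 hn3] := cvg_reject_prob h1 d0.
exists (maxn n1 (maxn n2 n3)) => n; rewrite !geq_max => /and3P[/hn1 c1 n2n /hn3 c3].
rewrite ltNge; apply/negP => hM.
have hM' : gsum p (theta n) n.+1 <= Num.max M 0 * sqrtn n.+1.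
  by apply: (le_trans hM); rewrite ler_wpM2r ?sqrtr_ge0// le_max lexx.
have := hn2 n.+1 _ n2n hM'.
have : (P [set w | (nsum p (theta n) n.+1 w < n.+1%:R * mu p - t * sqrtn n.+1)%R] <=
  P [set w | (nsum p (theta n) n.+1 w < c n)%R])%E.
  apply: le_measure; rewrite ?inE; try exact: measurable_psum_lt.
  by move=> w /= /lt_le_trans; apply; case/andP: c1.
rewrite [X in (_ <= X)%E -> _]psum_lt_prob// => hP /le_trans/(_ hP).
by rewrite lee_fin; move: c3; rewrite ltr_norml => /andP[]; lra.
Qed.

Lemma gsum_diverges_consistent (theta : nat -> nat -> R) : gsum_diverges p theta ->
  ((reject_prob p (c n) (theta n) n.+1)%:E @[n --> \oo] --> 1%:E)%E.
Proof.
move=> hg; have [t t0 [n1 hn1]] := threshold_bounds p0 a01 hc.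
apply: cvg_EFin; first exact: nearW.
apply/cvgrPdist_lt => e e0.
have e20 : 0 < e / 2 by rewrite divr_gt0.
have [M M0 hM] := psum_small_prob heps p0 t0 e20.
have [n2 hn2] := hg M.
exists (maxn n1 n2) => // n /=; rewrite geq_max => /andP[/hn1 c1 /hn2 /ltW g1].
have := hM n.+1 _ (ltn0Sn n) g1.
have : (P [set w | (nsum p (theta n) n.+1 w < c n)%R] <=
  P [set w | (nsum p (theta n) n.+1 w < n.+1%:R * mu p + t * sqrtn n.+1)%R])%E.
  apply: le_measure; rewrite ?inE; try exact: measurable_psum_lt.
  by move=> w /= /lt_le_trans; apply; case/andP: c1.
rewrite psum_lt_prob// => /le_trans h /h; rewrite lee_fin => {}h.
have r1 : reject_prob p (c n) (theta n) n.+1 <= 1.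
  rewrite -lee_fin -reject_probE//; apply: probability_le1; exact: measurable_psum_ge.
by rewrite ger0_norm; lra.
Qed.

End Threshold.

End Asymptotics.

Lemma gsum_diverges_mono (R : realType) (p q : R) (theta : nat -> nat -> R) : p <= q ->
  gsum_diverges p theta -> gsum_diverges q theta.
Proof.
move=> pq h M; have [n0 hn] := h M; exists n0 => n /hn /lt_le_trans; apply.
by apply: ler_sum => i _; exact: gfun_mono.
Qed.

(** * Strictness of the inclusion: one large coordinate *)

Section Spike.
Context {R : realType}.
Variables (p q : R).
Hypotheses (p0 : 0 < p) (pq : p < q).

Definition spike (n : nat) (x : R) : 'rV[R]_n.+1 := \row_j (if j == 0 then x else 0).

Lemma gsum_spike r n (x : R) : 1 <= x ->
  gsum r (row_coeffs (spike n x)) n.+1 = x `^ r.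
Proof.
move=> x1; rewrite /gsum big_ord_recl big1 ?addr0; last first.
  move=> i _; rewrite /row_coeffs inord_val mxE /=.
  by rewrite /gfun normr0 ler01 expr0n.
rewrite /row_coeffs (inord_val (ord0 : 'I_n.+1)) mxE eqxx /gfun ger0_norm ?(le_trans ler01)//.
case: (leP x 1) => // x1'; have -> : x = 1 by apply/eqP; rewrite eq_le x1' x1.
by rewrite powR1 expr1n.
Qed.

(** The exponent makes [d^p] exactly the square root of the dimension, while [d^q] is that root to
    the power [q / p > 1]. *)
Let d (n : nat) : R := n.+1%:R `^ (2 * p)^-1.

Let d1 n : 1 <= d n.
Proof.
rewrite /d -[leLHS](powRr0 n.+1%:R) ler_powR ?ler1n//.
by rewrite invr_ge0 mulr_ge0// ltW.
Qed.

Let dX n r : d n `^ r = Num.sqrt n.+1%:R `^ (r / p).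
Proof.
rewrite /d -powRrM -powR12_sqrt// -powRrM; congr (_ `^ _).
by field; rewrite gt_eqF.
Qed.

Lemma spike_not_diverges : ~ gsum_diverges p (fun n => row_coeffs (spike n (d n))).
Proof.
(* The ratio equals 1 in every dimension, so the strict inequality with [M = 1] never holds. *)
move=> /(_ 1) [n /(_ n (leqnn n))].
by rewrite gsum_spike// dX divff ?gt_eqF// powRr1 ?sqrtr_ge0// mul1r ltxx.
Qed.

Lemma spike_diverges : gsum_diverges q (fun n => row_coeffs (spike n (d n))).
Proof.
move=> M; pose e := q / p - 1.
have e0 : 0 < e by rewrite subr_gt0 ltr_pdivlMr// mul1r.
(* A root [r >= K] satisfies [r^e >= max M 0 + 1 > M], the surplus factor over [r]. *)
pose K := (Num.max M 0 + 1) `^ e^-1.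
have K0 : 0 <= K by exact: powR_ge0.
have M0 : 0 <= Num.max M 0 by rewrite le_max lexx orbT.
exists (Num.bound (K ^+ 2)) => n hn.
rewrite gsum_spike// dX; set r := Num.sqrt _.
have r0 : 0 < r by rewrite sqrtr_gt0 ltr0n.
have Kr : K <= r.
  rewrite -ler_sqr ?nnegrE ?(ltW r0)// sqr_sqrtr//.
  have /ltW/le_trans := archi_boundP (sqr_ge0 K); apply.
  by rewrite ler_nat (leq_trans hn).
have -> : r `^ (q / p) = r `^ e * r.
  have -> : q / p = e + 1 by rewrite subrK.
  rewrite powRD; last by rewrite (gt_eqF r0) implybT.
  by rewrite powRr1 ?ltW.
rewrite ltr_pM2r//.
have : Num.max M 0 + 1 <= r `^ e.
  have h1 : 0 <= Num.max M 0 + 1 by rewrite addr_ge0.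
  by rewrite -(powR_invK e0 h1) powR_le_inv// ltW.
have : M <= Num.max M 0 by rewrite le_max lexx.
by lra.
Qed.

End Spike.

Theorem theorem3p3 (R : realType) (disp : measure_display)
    (T : measurableType disp) (P : probability T R)
    (eps : nat -> {RV P >-> R}) (heps : iid_standard_normal eps)
    (p q : R) (hp : 0 < p) (hpq : p < q)
    (kappa_p kappa_q : nat -> R) (alpha_p alpha_q : R)
    (halpha_p : 0 < alpha_p < 1) (halpha_q : 0 < alpha_q < 1)
    (hsize_p : has_asymptotic_size eps (pnorm_tests p kappa_p) alpha_p)
    (hsize_q : has_asymptotic_size eps (pnorm_tests q kappa_q) alpha_q) :
  consistency_set eps (pnorm_tests p kappa_p) `<`
    consistency_set eps (pnorm_tests q kappa_q).
Proof.
have hq : 0 < q := lt_trans hp hpq.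
pose c (r : R) (kappa : nat -> R) n := Num.max (kappa n) 0 `^ r.
have size r kappa a : 0 < r -> has_asymptotic_size eps (pnorm_tests r kappa) a ->
    ((@reject_prob R disp T P eps r (c r kappa n) (fun=> 0%R) n.+1)%:E @[n --> \oo] --> a%:E)%E.
  move=> r0; rewrite /has_asymptotic_size.
  have -> : (fun n => 'E_P[fun w => pnorm_tests r kappa n (noise_vec eps n.+1 w)])%E =
      (fun n => (@reject_prob R disp T P eps r (c r kappa n) (fun=> 0%R) n.+1)%:E).
    apply/funext => n.
    have c0 : row_coeffs (0 : 'rV[R]_n.+1) = fun=> 0.
      by apply/funext => i; rewrite /row_coeffs mxE.
    have H := @expectation_pnorm_test R disp T P eps r kappa n 0 r0.
    transitivity ('E_P[fun w => pnorm_tests r kappa n (0 + noise_vec eps n.+1 w)%R])%E.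
      by under [in RHS]eq_fun => w do rewrite add0r.
    by rewrite H c0.
  by [].
(* The right-hand side depends on the exponent alone: critical values and size have disappeared, and
   the two consistency sets become comparable. *)
have consE r kappa a : 0 < r -> 0 < a < 1 ->
    has_asymptotic_size eps (pnorm_tests r kappa) a ->
    consistency_set eps (pnorm_tests r kappa) =
    [set theta | gsum_diverges r (fun n => row_coeffs (theta n))].
  move=> r0 a01 /(size _ _ _ r0) hc.
  have E (theta : triangular_array R) :
      (fun n => 'E_P[fun w => pnorm_tests r kappa n (theta n + noise_vec eps n.+1 w)%R])%E =
      (fun n => (@reject_prob R disp T P eps r (c r kappa n) (row_coeffs (theta n)) n.+1)%:E).
    by apply/funext => n; exact: expectation_pnorm_test.
  apply/seteqP; split => theta; rewrite /consistency_set/= E.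
    exact: (consistent_gsum_diverges heps r0 a01 hc).
  exact: (gsum_diverges_consistent heps r0 a01 hc).
rewrite (consE _ _ _ hp halpha_p hsize_p) (consE _ _ _ hq halpha_q hsize_q).
split.
  by move=> theta; exact: gsum_diverges_mono (ltW hpq).
move=> /(_ (fun n => spike n (n.+1%:R `^ (2 * p)^-1))) /=.
by move=> /(_ (spike_diverges hp hpq)); exact: spike_not_diverges.
Qed.
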